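(* Let $p$ be an odd prime. Then $$\sum_{k=0}^{p-1}\frac{\binom{2k}k}{2^k}\equiv (-1)^{(p-1)/2}-p^2E_{p-3}\pmod{p^3}.$$ If $p>3$, then $$\sum_{k=1}^{(p-1)/2}\frac{\binom{2k}k}k\equiv (-1)^{(p+1)/2}\,\frac 83pE_{p-3}\pmod{p^2} \quad\text{and}\quad \sum_{k=1}^{(p-1)/2}\frac1{k^2\binom{2k}k}\equiv(-1)^{(p-1)/2}\,\frac 43E_{p-3}\pmod{p}.$$ Moreover (for every odd prime $p$) $$\sum_{k=1}^{(p-1)/2}\frac{4^k}{k^2\binom{2k}k}\equiv(-1)^{(p-1)/2}\,4E_{p-3}\pmod{p} \quad\text{and}\quad \sum_{p/2<k<p}\frac{\binom{2k}k}{k4^k}\equiv (-1)^{(p-1)/2}\,2pE_{p-3}\pmod{p^2}.$$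
   Context: Euler numbers $E_0,E_1,E_2,\ldots$ are the integers defined by $E_0=1$ and $\sum_{0\le k\le n,\ 2\mid k}\binom nk E_{n-k}=0$ for $n\ge1$ (equivalently $\sec x=\sum_{n\ge0}(-1)^nE_{2n}x^{2n}/(2n)!$). A congruence $a\equiv b\pmod{p^m}$ between rational numbers whose denominators are prime to $p$ means that $(a-b)/p^m$ is a rational number with denominator prime to $p$. *)

(* Defs.v *)
From mathcomp Require Import all_boot all_order all_algebra.
Set Implicit Arguments.
Unset Strict Implicit.
Unset Printing Implicit Defensive.

Import Order.TTheory GRing.Theory Num.Theory.
Local Open Scope ring_scope.

(* [:: E_0; ...; E_n], each new entry being obtained by solving
   \sum_(0 <= k <= n, 2 | k) 'C(n, k) E_(n-k) = 0 for its k = 0 term;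
   see [euler_recurrence] and [euler_unique] below. *)
Fixpoint euler_seq (n : nat) : seq int :=
  if n is m.+1 then
    rcons (euler_seq m)
      (- \sum_(1 <= k < m.+2 | (2 %| k)%N)
           'C(m.+1, k)%:R * (euler_seq m)`_(m.+1 - k))
  else [:: 1].

Definition euler (n : nat) : int := (euler_seq n)`_n.

Definition p_integral (p : nat) (x : rat) : bool := coprime p `|denq x|.

(* Reducing modulo p ^ m is only meant for p-integral a and b; if one of them
   is p-integral, this congruence forces the other one to be so too. *)
Definition rat_congr (p m : nat) (a b : rat) : bool :=
  p_integral p ((a - b) / p%:R ^+ m).

Notation "a ≡ b %[ 'modr' p ^ m ]" := (rat_congr p m a b)
  (at level 70, b at level 69, p at level 1, m at level 1,
   format "a  ≡  b  %[ 'modr'  p  ^  m ]") : ring_scope.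

Lemma size_euler_seq n : size (euler_seq n) = n.+1.
Proof. by elim: n => //= n IHn; rewrite size_rcons IHn. Qed.

Lemma nth_euler_seq n i : (i <= n)%N -> (euler_seq n)`_i = euler i.
Proof.
elim: n => [|n IHn]; first by rewrite leqn0 => /eqP->.
rewrite leq_eqVlt => /orP[/eqP-> //|lt_in].
by rewrite /= nth_rcons size_euler_seq lt_in IHn.
Qed.

Lemma euler0 : euler 0 = 1. Proof. by []. Qed.

Lemma euler_sum_recl (E : nat -> int) n :
  \sum_(0 <= k < n.+2 | (2 %| k)%N) 'C(n.+1, k)%:R * E (n.+1 - k)%N =
  E n.+1 + \sum_(1 <= k < n.+2 | (2 %| k)%N) 'C(n.+1, k)%:R * E (n.+1 - k)%N.
Proof. by rewrite big_ltn_cond // dvdn0 bin0 mul1r subn0. Qed.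

Lemma eulerS n : euler n.+1 =
  - \sum_(1 <= k < n.+2 | (2 %| k)%N) 'C(n.+1, k)%:R * euler (n.+1 - k).
Proof.
rewrite {1}/euler [euler_seq n.+1]/= nth_rcons size_euler_seq ltnn eqxx.
congr (- _); rewrite [LHS]big_nat_cond [RHS]big_nat_cond.
apply: eq_bigr => k /andP[/andP[k_gt0 _] _]; rewrite nth_euler_seq //.
by rewrite leq_subLR -add1n leq_add2r.
Qed.

Lemma euler_recurrence n : (0 < n)%N ->
  \sum_(0 <= k < n.+1 | (2 %| k)%N) 'C(n, k)%:R * euler (n - k) = 0.
Proof. by case: n => // n _; rewrite euler_sum_recl eulerS addNr. Qed.

Lemma euler_unique (E : nat -> int) : E 0%N = 1 ->
    (forall n, (0 < n)%N ->
       \sum_(0 <= k < n.+1 | (2 %| k)%N) 'C(n, k)%:R * E (n - k)%N = 0) ->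
  E =1 euler.
Proof.
move=> E0 Erec n; have [m] := ubnP n; elim: m n => // m IHm [|n] ltnm.
  by rewrite E0.
have /eqP := Erec n.+1 isT; rewrite euler_sum_recl addr_eq0 eulerS => /eqP->.
congr (- _); rewrite [LHS]big_nat_cond [RHS]big_nat_cond.
apply: eq_bigr => k /andP[/andP[k_gt0 _] _]; rewrite IHm //.
by apply: leq_ltn_trans (_ : n < m)%N => //; rewrite leq_subLR -add1n leq_add2r.
Qed.

(* Main.v *)
Require Import Defs.
From HB Require Import structures.
From mathcomp Require Import all_boot all_order all_algebra.
From mathcomp Require Import cyclic ring zify.
Set Implicit Arguments.
Unset Strict Implicit.
Unset Printing Implicit Defensive.

Import Order.TTheory GRing.Theory Num.Theory.
Local Open Scope ring_scope.

(* Write p = 2n+1 and E = E_(p-3).  Euler polynomials, evaluated modulo p and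
   p^2, express the sums of (-1)^j/j^2 and (-1)^j/j over j <= n through E and
   2^(p-1).  The five congruences then follow from exact identities.

   - The sum of C(2k,k) 2^(p-k) over k < p is, up to sign, 2 Re sum C(2p,k) i^k.
     Modulo p^3, C(2p,k) is 4 C(p,k) + (-1)^k 2p/k, while Re (1+i)^p squares to
     2^(p-1); what remains is the sum of (-1)^j/j modulo p^2.
   - For k <= n, C(2k,k) = (-4)^k C(n,k) modulo p, so the sum of
     4^k/(k^2 C(2k,k)) is the sum of (-1)^k/(k^2 C(n,k)), which reduces to the
     sums of 1/j^2 and (-1)^j/j^2.  Since C(2(p-k),p-k)/(p-k) is
     2p/(k^2 C(2k,k)) modulo p^2, this also gives the sum over p/2 < k < p.
   - Let A, B be the sums over k <= n of 1/(k^2 C(2k,k)) and 1/(k^2 C(n,k)^2).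
     Apery's identity for zeta(2) relates A, B and E modulo p.  By Staver's
     identity the sum of C(2k,k)/k is a multiple of B over k <= n, and 0 modulo
     p^2 over k < p; with the reflection k -> p-k this is a second linear
     relation between A and B. *)

(** * Binomial identities *)

Lemma binr_neq0 n k : (k <= n)%N -> 'C(n, k)%:R != 0 :> rat.
Proof. by move=> kn; rewrite pnatr_eq0 -lt0n bin_gt0. Qed.

Lemma binrSr n k :
  'C(n, k.+1)%:R = 'C(n, k)%:R * (n%:R - k%:R) / k.+1%:R :> rat.
Proof.
have k0 : k.+1%:R != 0 :> rat by rewrite pnatr_eq0.
apply: (canRL (mulfK k0)); have [lekn | ltnk] := leqP k n.
  by rewrite -natrB // -!natrM mulnC mul_bin_left mulnC.
by rewrite !bin_small ?mul0r // ltnS ltnW.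
Qed.

Lemma binrSl n k : (k <= n)%N ->
  'C(n.+1, k)%:R = 'C(n, k)%:R * n.+1%:R / (n.+1%:R - k%:R) :> rat.
Proof.
move=> kn; have k0 : n.+1%:R - k%:R != 0 :> rat.
  by rewrite -natrB ?leqW // pnatr_eq0 -lt0n subn_gt0.
apply: (canRL (mulfK k0)).
by rewrite -natrB ?leqW // -!natrM mulnC -mul_bin_down mulnC.
Qed.

Lemma binrSS n k :
  'C(n.+1, k.+1)%:R = 'C(n, k)%:R * n.+1%:R / k.+1%:R :> rat.
Proof.
have k0 : k.+1%:R != 0 :> rat by rewrite pnatr_eq0.
apply: (canRL (mulfK k0)).
by rewrite -!natrM mulnC -mul_bin_diag mulnC.
Qed.

Lemma central_binrS k :
  'C(2 * k.+1, k.+1)%:R =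
  'C(2 * k, k)%:R * (2 * (2 * k%:R + 1)) / k.+1%:R :> rat.
Proof.
rewrite mulnS add2n binrSS binrSl; last by lia.
have k0 : k.+1%:R != 0 :> rat by rewrite pnatr_eq0.
by rewrite -!natr1 !natrM; field; rewrite natr1 k0.
Qed.

(* Consecutive sums differ by the telescoping sum of (-1)^k / (n k C(n, k)). *)
Lemma sum_alt_inv_bin n :
  \sum_(1 <= k < n.+1) (-1) ^+ k / (k%:R ^+ 2 * 'C(n, k)%:R) =
  \sum_(1 <= k < n.+1) (1 + 2 * (-1) ^+ k) / k%:R ^+ 2 :> rat.
Proof.
elim: n => [|n IHn]; first by rewrite !big_geq.
rewrite [RHS]big_nat_recr //= -IHn [LHS]big_nat_recr //= binn mulr1.
have n0 : n.+1%:R != 0 :> rat by rewrite pnatr_eq0.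
pose G k : rat := (-1) ^+ k / (n.+1%:R * k%:R * 'C(n.+1, k)%:R).
have : \sum_(1 <= k < n.+1) ((-1) ^+ k / (k%:R ^+ 2 * 'C(n.+1, k)%:R)
   - (-1) ^+ k / (k%:R ^+ 2 * 'C(n, k)%:R)) = G n.+1 - G 1%N :> rat.
  apply: telescope_sumr_eq => // k /andP[k0 kn]; rewrite /G.
  have kR : k%:R != 0 :> rat by rewrite pnatr_eq0 -lt0n.
  have kS : k.+1%:R != 0 :> rat by rewrite pnatr_eq0.
  have c0 : 'C(n, k)%:R != 0 :> rat by exact: binr_neq0.
  have nk : n.+1%:R - k%:R != 0 :> rat.
    by rewrite subr_eq0 eqr_nat gtn_eqF.
  (* Everything is written through C(n, k), after which the telescoping step is an identity of
     rational functions in n and k. *)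
  by rewrite binrSr binrSl // [_ ^+ k.+1]exprS; field;
    rewrite !nat1r c0 kR kS n0 nk.
rewrite sumrB => /eqP; rewrite subr_eq => /eqP ->.
rewrite /G binn bin1 !mulr1 expr1; field.
by rewrite nat1r.
Qed.

(* Telescopes with (2k - 3(n+2)) / C(n+1, k)^2. *)
Lemma sum_inv_sqr_binS n :
  2 * (2 * n%:R + 5) * (\sum_(0 <= k < n.+2) ('C(n.+1, k)%:R ^+ 2)^-1) =
  (n.+2%:R) ^+ 3 / n.+1%:R ^+ 2 *
    (\sum_(0 <= k < n.+1) ('C(n, k)%:R ^+ 2)^-1) + 6 * n.+2%:R :> rat.
Proof.
have n0 : n.+1%:R != 0 :> rat by rewrite pnatr_eq0.
pose G k : rat := (2 * k%:R - 3 * n.+2%:R) / 'C(n.+1, k)%:R ^+ 2.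
have : \sum_(0 <= k < n.+1) (2 * (2 * n%:R + 5) * ('C(n.+1, k)%:R ^+ 2)^-1
   - (n.+2%:R) ^+ 3 / n.+1%:R ^+ 2 * ('C(n, k)%:R ^+ 2)^-1)
   = G n.+1 - G 0%N :> rat.
  apply: telescope_sumr_eq => // k /andP[k0 kn]; rewrite /G.
  have kS : k.+1%:R != 0 :> rat by rewrite pnatr_eq0.
  have c0 : 'C(n, k)%:R != 0 :> rat by exact: binr_neq0.
  have nk : n.+1%:R - k%:R != 0 :> rat.
    by rewrite subr_eq0 eqr_nat gtn_eqF.
  by rewrite binrSr binrSl //; field; rewrite !nat1r c0 kS n0 nk.
rewrite sumrB -!mulr_sumr => /eqP; rewrite subr_eq => /eqP EG.
rewrite big_nat_recr //= mulrDr EG /G binn bin0.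
by field; rewrite nat1r.
Qed.

(** Induction on n: in [sum_inv_sqr_binS] the homogeneous part reproduces the previous right-hand
    side, and the term 6(n+2) contributes exactly the new summand C(2n+4, n+2)/(n+2). *)
Lemma staver n :
  \sum_(1 <= k < n.+2) 'C(2 * k, k)%:R / k%:R =
  n.+2%:R / (3 * n.+1%:R ^+ 2) * 'C(2 * n + 3, n.+1)%:R *
    (\sum_(0 <= k < n.+1) ('C(n, k)%:R ^+ 2)^-1) :> rat.
Proof.
elim: n => [|n IHn]; first by rewrite !big_nat1.
have n1 : n.+1%:R != 0 :> rat by rewrite pnatr_eq0.
have n2 : n.+2%:R != 0 :> rat by rewrite pnatr_eq0.
have n3 : n.+3%:R != 0 :> rat by rewrite pnatr_eq0.
have n5 : 2 * n%:R + 5 != 0 :> rat.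
  by rewrite -!natrM -natrD pnatr_eq0 addnS.
rewrite big_nat_recr //= IHn.
(* Multiplying and dividing by 2(2n+5) exposes the left-hand side of the recurrence. *)
rewrite -[X in _ = _ * X](mulKf (_ : 2 * (2 * n%:R + 5) != 0)); last first.
  by rewrite mulf_neq0.
rewrite sum_inv_sqr_binS.
have -> : (2 * n.+1 + 3 = (2 * n + 3).+2)%N by lia.
have -> : (2 * n.+2 = (2 * n + 3).+1)%N by lia.
rewrite binrSS [X in _ = _ * X * _]binrSS.
rewrite binrSl; last by lia.
have -> : (2 * n + 3).+1%:R - n.+1%:R = n.+3%:R :> rat.
  by rewrite -natrB; [congr _%:R; lia | lia].
set R := \sum_(_ <= _ < _) _; set C := 'C(_, _)%:R.
by field; apply/and4P; split; rewrite // ?nat1r // -natrD.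
Qed.

(** Absorption, k C(n, k) = n C(n-1, k-1), reindexes [staver]. In this form a factor p is visible in
    both applications: in C(2n+1, n) when p = 2n+1, and in n+1 when n = p-1. *)
Lemma staver_bin n :
  \sum_(1 <= k < n.+1) 'C(2 * k, k)%:R / k%:R = n.+1%:R / 3 * 'C(2 * n + 1,
    n)%:R *
    (\sum_(1 <= k < n.+1) (k%:R ^+ 2 * 'C(n, k)%:R ^+ 2)^-1) :> rat.
Proof.
case: n => [|n]; first by rewrite !big_geq ?mulr0.
have n0 : n.+1%:R != 0 :> rat by rewrite pnatr_eq0.
rewrite staver big_add1 /= !mulr_sumr; apply: eq_big_nat => k kn.
have -> : (2 * n.+1 + 1 = 2 * n + 3)%N by lia.
rewrite binrSS; have c0 : 'C(n, k)%:R != 0 :> rat by exact: binr_neq0.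
have k0 : k.+1%:R != 0 :> rat by rewrite pnatr_eq0.
by field; rewrite !nat1r n0 c0 k0.
Qed.

(* Apery's identity behind the irrationality of zeta(2), by induction on n: the
   increments telescope with -2(n+1+k)/(n+1) times the k-th term. *)
Lemma apery n :
  3 * (\sum_(1 <= k < n.+1) (k%:R ^+ 2 * 'C(2 * k, k)%:R)^-1) +
  2 * (\sum_(1 <= k < n.+1) (-1) ^+ k / k%:R ^+ 2) +
  (-1) ^+ n * (\sum_(1 <= k < n.+1)
    (-1) ^+ k / (k%:R ^+ 2 * 'C(n, k)%:R * 'C(n + k, k)%:R)) = 0 :> rat.
Proof.
elim: n => [|n IHn]; first by rewrite !big_geq // !mulr0 !addr0.
have n0 : n.+1%:R != 0 :> rat by rewrite pnatr_eq0.
pose t m k : rat := (-1) ^+ k / (k%:R ^+ 2 * 'C(m, k)%:R * 'C(m + k, k)%:R).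
pose G k : rat :=
  - (2 * (n.+1%:R + k%:R) / n.+1%:R) * t n.+1 k.
have : \sum_(1 <= k < n.+1) (t n.+1 k + t n k) = G n.+1 - G 1%N :> rat.
  apply: telescope_sumr_eq => // k /andP[k0 kn]; rewrite /G /t.
  have kR : k%:R != 0 :> rat by rewrite pnatr_eq0 -lt0n.
  have kS : k.+1%:R != 0 :> rat by rewrite pnatr_eq0.
  have c0 : 'C(n, k)%:R != 0 :> rat by exact: binr_neq0.
  have d0 : 'C(n + k, k)%:R != 0 :> rat by apply: binr_neq0; lia.
  have nk : n.+1%:R - k%:R != 0 :> rat.
    by rewrite subr_eq0 eqr_nat gtn_eqF.
  have nk1 : n.+1%:R + k%:R != 0 :> rat by rewrite -natrD pnatr_eq0.
  have nk2 : n.+2%:R + k%:R != 0 :> rat by rewrite -natrD pnatr_eq0.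
  rewrite addnS binrSr binrSS !addSn !(binrSl (_ : k <= n + k)%N) ?binrSl //;
    try lia.
  rewrite [_ ^+ k.+1]exprS; field.
  rewrite !addrA !nat1r nk kR kS c0 d0 nk1 -[2 + _]natrD nk2 !andbT /=.
  by rewrite -natrD -natrB ?pnatr_eq0 //; lia.
rewrite big_split /= => Et.
have En : \sum_(1 <= k < n.+1) t n.+1 k =
   G n.+1 - G 1%N - \sum_(1 <= k < n.+1) t n k by rewrite -Et addrK.
have sgn : (-1) ^+ n.+1 * (-1) ^+ n.+1 = 1 :> rat.
  by rewrite -exprMn mulrNN mulr1 expr1n.
rewrite ![\sum_(1 <= k < n.+2) _]big_nat_recr //=.
move: IHn; rewrite -![\sum_(1 <= k < n.+1) (-1) ^+ k / (_ * _ * _)]/(\sum_(1 <=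
  k < n.+1) t _ k).
rewrite En {En Et} /G /t binn addnn -mul2n bin1.
have c0 : 'C(2 * n.+1, n.+1)%:R != 0 :> rat by apply: binr_neq0; lia.
move: sgn; rewrite [_ ^+ n.+1]exprS !expr1 addn1 bin1.
set A := \sum_(_ <= _ < _) _; set B := \sum_(_ <= _ < _) _.
set S := \sum_(_ <= _ < _) _; set c := 'C(_, _)%:R in c0 *.
set s := (-1) ^+ n => ss IHn; rewrite -[RHS]IHn.
apply/eqP; rewrite -subr_eq0; apply/eqP.
rewrite [LHS](_ : _ = 3 / (n.+1%:R ^+ 2 * c) * (1 - (-1 * s) * (-1 * s))).
  by rewrite ss subrr mulr0.
by field; rewrite c0 nat1r n0 -natrD pnatr_eq0.
Qed.

(** * Reflection, parity and powers of the imaginary unit *)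

Lemma big_reflect (F : nat -> rat) N :
  \sum_(N.+1 <= k < (2 * N).+1) F k = \sum_(1 <= k < N.+1) F ((2 * N).+1 - k)%N.
Proof.
rewrite -[in LHS](add1n N) big_addn big_nat_rev.
have -> : ((2 * N).+1 - N = N.+1)%N by lia.
by apply: eq_big_nat => k kN; congr F; lia.
Qed.

Lemma sum_even (F : nat -> rat) N :
  \sum_(1 <= k < (2 * N).+1) (1 + (-1) ^+ k) * F k =
  2 * \sum_(1 <= k < N.+1) F (2 * k)%N.
Proof.
elim: N => [|N IHN]; first by rewrite !big_geq ?mulr0.
rewrite mulnS add2n (@big_nat_recr _ _ _ (2 * N).+2) // (@big_nat_recr _ _ _ (2
  * N).+1) //=.
rewrite IHN (@big_nat_recr _ _ _ N.+1) //= mulrDr.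
by rewrite !exprS -signr_odd oddM /= expr0 mulnS add2n; ring.
Qed.

(* The real part of the k-th power of the imaginary unit. *)
Definition re_iX (k : nat) : rat := if odd k then 0 else (-1) ^+ k./2.

Lemma re_iXSS k : re_iX k.+2 = - re_iX k.
Proof. by rewrite /re_iX /= negbK; case: odd; rewrite ?oppr0 // exprS mulN1r.
  Qed.

Lemma re_iX_odd k : odd k -> re_iX k = 0.
Proof. by rewrite /re_iX => ->. Qed.

Lemma re_iX_double k : re_iX (2 * k) = (-1) ^+ k.
Proof. by rewrite mul2n /re_iX odd_double doubleK. Qed.

Lemma re_iX_subl n k : (k <= 2 * n)%N -> re_iX (2 * n - k) = (-1) ^+ n * re_iX
  k.
Proof.
move=> kn; rewrite /re_iX oddB // oddM /=; case: ifP => [|/negbT k_even].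
  by rewrite mulr0.
rewrite -{1}(even_halfK k_even) -mul2n -mulnBr mul2n doubleK.
have kn' : (k./2 <= n)%N by lia.
by rewrite -[in RHS](subnK kn') exprD -mulrA -exprD addnn -mul2n exprM sqrrN
  !expr1n mulr1.
Qed.

Lemma sum_binS (v : nat -> rat) m n :
  \sum_(0 <= k < n.+1) 'C(m.+1, k)%:R * v k =
  \sum_(0 <= k < n.+1) 'C(m, k)%:R * v k +
  \sum_(0 <= k < n) 'C(m, k)%:R * v k.+1.
Proof.
rewrite !big_nat_recl // !bin0 -addrA -big_split /=; congr (_ + _).
by apply: eq_bigr => k _; rewrite binS natrD mulrDl.
Qed.

Lemma sum_binS_full (v : nat -> rat) n :
  \sum_(0 <= k < n.+2) 'C(n.+1, k)%:R * v k =
  \sum_(0 <= k < n.+1) 'C(n, k)%:R * (v k + v k.+1).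
Proof.
rewrite sum_binS big_nat_recr //= bin_small // mul0r addr0 -big_split /=.
by apply: eq_bigr => k _; rewrite mulrDr.
Qed.

(** Induction on n. Two applications of Pascal's rule replace the weight v_k by v_k + 2 v_(k+1) +
    v_(k+2), and v_(k+2) = -v_k leaves twice the previous sum. The boundary term at k = n, where v_n
    = Re i^2 = -1, supplies the new central binomial. *)
Lemma sum_central_bin_pow2 n :
  2 ^+ n * (\sum_(0 <= k < n) 'C(2 * k, k)%:R / 2 ^+ k) =
  - 2 * \sum_(0 <= k < n) 'C(2 * n, k)%:R * re_iX (n - k).+1 :> rat.
Proof.
elim: n => [|n IHn]; first by rewrite !big_geq ?mulr0.
rewrite big_nat_recr //= mulrDr exprS -mulrA IHn.
rewrite -!mulrA [2 ^+ n * (_ / _)]mulrCA divff ?expf_neq0 // mulr1.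
pose v k := re_iX (n.+1 - k).+1.
have vn : v n.+1 = 0 by rewrite /v subnn.
rewrite mulnS add2n -/(v _) [in RHS](eq_bigr (fun k => 'C((2 * n).+2, k)%:R * v
  k)) //.
rewrite sum_binS.
(* The term k = n may be added because v_(n+1) = Re i = 0; both sums then have the same range for
   the second use of Pascal's rule. *)
have -> : \sum_(0 <= k < n) 'C((2 * n).+1, k)%:R * v k.+1 =
          \sum_(0 <= k < n.+1) 'C((2 * n).+1, k)%:R * v k.+1.
  by rewrite [RHS]big_nat_recr //= vn mulr0 addr0.
rewrite !sum_binS ![\sum_(_ <= _ < n.+1) _]big_nat_recr //= vn.
have -> : \sum_(0 <= k < n) 'C(2 * n, k)%:R * v k.+2 =
          - \sum_(0 <= k < n) 'C(2 * n, k)%:R * v k.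
  rewrite -sumrN; apply: eq_big_nat => k /andP[_ kn]; rewrite -mulrN /v.
  have -> : (n.+1 - k = (n.+1 - k.+2).+2)%N by lia.
  by rewrite re_iXSS opprK.
have -> : v n = -1 by rewrite /v subSnn.
rewrite (eq_bigr (fun k => 'C(2 * n, k)%:R * re_iX (n - k).+1)) //.
by ring.
Qed.

(** The sum is Re (1+i)^(2n+1), and (1+i)^2 = 2i. The induction also carries Re i(1+i)^(2n+1), since
    multiplication by 2i exchanges the two sums up to sign and a factor 2. *)
Lemma sqr_sum_bin_re_iX n :
  (\sum_(0 <= k < (2 * n).+2) 'C((2 * n).+1, k)%:R * re_iX k) ^+ 2 = 2 ^+ (2 *
    n).
Proof.
suff []: (\sum_(0 <= k < (2 * n).+2) 'C((2 * n).+1, k)%:R * re_iX k) ^+ 2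
    = 2 ^+ (2 * n) /\
  (\sum_(0 <= k < (2 * n).+2) 'C((2 * n).+1, k)%:R * re_iX k.+1) ^+ 2
    = 2 ^+ (2 * n) by [].
elim: n => [|n [IH1 IH2]].
  by split; rewrite !big_nat_recr // big_geq.
have step (v : nat -> rat) (vS : forall k, v k.+2 = - v k) :
    \sum_(0 <= k < (2 * n).+4) 'C((2 * n).+3, k)%:R * v k =
    2 * \sum_(0 <= k < (2 * n).+2) 'C((2 * n).+1, k)%:R * v k.+1.
  rewrite 2!sum_binS_full mulr_sumr; apply: eq_bigr => k _.
  by rewrite vS; ring.
rewrite mulnS add2n !step ?exprMn ?IH2 => [|k|k]; try exact: re_iXSS.
under eq_bigr do rewrite re_iXSS mulrN.
by rewrite sumrN sqrrN IH1 -exprD.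

Qed.

(** * Euler numbers *)

(* The linear functional with X^k |-> E_k. *)
Definition euler_umbra (q : {poly int}) : int :=
  \sum_(0 <= i < size q) q`_i * euler i.

Lemma euler_umbra_widen (q : {poly int}) n : (size q <= n)%N ->
  euler_umbra q = \sum_(0 <= i < n) q`_i * euler i.
Proof.
move=> qn; rewrite [RHS](big_cat_nat (leq0n _) qn) /=.
rewrite [X in _ = _ + X]big1_seq ?addr0 // => i /andP[_].
by rewrite mem_index_iota => /andP[qi _]; rewrite nth_default ?mul0r.
Qed.

Lemma euler_umbra_is_scalar : scalar euler_umbra.
Proof.
move=> a q r; pose n := maxn (size q) (maxn (size r) (size (a *: q + r))).
rewrite !(@euler_umbra_widen _ n) /n ?leq_max ?leqnn ?orbT //.
rewrite mulr_sumr -big_split; apply: eq_bigr => i _ /=.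
by rewrite coefD coefZ mulrDl mulrA.
Qed.

HB.instance Definition _ :=
  GRing.isLinear.Build int {poly int} int *%R euler_umbra euler_umbra_is_scalar.

Lemma euler_umbraX n : euler_umbra 'X^n = euler n.
Proof.
rewrite /euler_umbra size_polyXn big_nat_recr //= coefXn eqxx mul1r.
rewrite big1_seq ?add0r // => i /andP[_].
by rewrite mem_index_iota coefXn => /andP[_ /ltn_eqF->]; rewrite mul0r.
Qed.

Lemma euler_umbra_XaddC c n : euler_umbra (('X + c%:P) ^+ n) =
  \sum_(0 <= k < n.+1) 'C(n, k)%:R * c ^+ k * euler (n - k).
Proof.
rewrite exprDn linear_sum big_mkord; apply: eq_bigr => k _ /=.
rewrite -polyC_exp mulrC mul_polyC -scaler_nat scalerA linearZ /=.
by rewrite euler_umbraX.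
Qed.

(** By linearity it suffices to take q = X^i: in the sum of the two expansions the odd powers of the
    shift cancel and the even ones double, leaving twice the defining recurrence, which vanishes
    unless i = 0. *)
Lemma euler_umbra_shift (q : {poly int}) :
  euler_umbra (q \Po ('X + 1%:P)) + euler_umbra (q \Po ('X + (-1)%:P)) =
  2 * q`_0.
Proof.
rewrite !comp_polyE !linear_sum -big_split /=.
have E i : euler_umbra (('X + 1%:P) ^+ i) + euler_umbra (('X + (-1)%:P) ^+ i) =
    2 * (i == 0)%:R.
  rewrite !euler_umbra_XaddC -big_split /=; case: i => [|i].
    by rewrite big_nat1 !expr0 bin0.
  rewrite mulr0 -[X in _ = X](mulr0 2) -[X in _ = _ * X](euler_recurrence
    (ltn0Sn i)) mulr_sumr.
  rewrite [RHS]big_mkcond /=; apply: eq_bigr => k _.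
  rewrite expr1n mulr1 dvdn2 -signr_odd; case: odd => /=; first by ring.
  by ring.
rewrite (eq_bigr (fun i : 'I__ => q`_i * (2 * (i == 0 :> nat)%:R))); last first.
  by move=> i _; rewrite !linearZ -mulrDr /= E.
case: (posnP (size q)) => [q0|q_gt0].
  by rewrite nth_default ?q0 // big_ord0 mulr0.
rewrite -(big_mkord xpredT (fun i => q`_i * (2 * (i == 0)%:R))).
rewrite big_ltn // big1_seq ?addr0 ?mulr1 1?mulrC // => i /andP[_].
by rewrite mem_index_iota => /andP[/lt0n_neq0/negbTE-> _]; rewrite !mulr0.
Qed.

(** Strong induction: at odd index the recurrence only involves smaller odd indices. *)
Lemma euler_odd n : odd n -> euler n = 0.
Proof.
have [m] := ubnP n; elim: m n => // m IHm [|n] // lt_nm n_odd.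
rewrite eulerS big_nat_cond big1 ?oppr0 // => k /andP[/andP[k1 kn] k_even].
rewrite IHm ?mulr0 //; first by lia.
by rewrite oddB // n_odd -[odd k]negbK -dvdn2 k_even.
Qed.

(* [euler_poly n] at y is 2^n times the Euler polynomial E_n at (y + 1) / 2. *)
Definition euler_poly (n : nat) (y : int) : int :=
  euler_umbra (('X + y%:P) ^+ n).

Lemma euler_poly0 n : euler_poly n 0 = euler n.
Proof. by rewrite /euler_poly addr0 euler_umbraX. Qed.

Lemma euler_poly_step n y :
  euler_poly n (y + 1) + euler_poly n (y - 1) = 2 * y ^+ n.
Proof.
have := euler_umbra_shift (('X + y%:P) ^+ n).
rewrite !rmorphXn /= !comp_polyD !comp_polyX !comp_polyC.
rewrite -!addrA -!polyCD ![_ + y]addrC => ->.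
by rewrite -horner_coef0 hornerE !(hornerD, hornerX, hornerC) add0r.
Qed.

(** For even n the polynomial is even in y, because odd Euler numbers vanish; the step relation at y
    = 0 then reads 2 [euler_poly n 1] = 0. *)
Lemma euler_poly1 n : (0 < n)%N -> ~~ odd n -> euler_poly n 1 = 0.
Proof.
move=> n_gt0 n_even; have := euler_poly_step n 0.
rewrite expr0n gtn_eqF // mulr0 add0r sub0r.
suff -> : euler_poly n (-1) = euler_poly n 1 by lia.
rewrite /euler_poly !euler_umbra_XaddC; apply: eq_bigr => k _.
rewrite expr1n -signr_odd; case: (boolP (odd k)) => // k_odd.
have [nk|kn] := ltnP n k; first by rewrite bin_small // !mul0r.
by rewrite euler_odd ?mulr0 // oddB // (negbTE n_even).
Qed.

Lemma exprD_order2 (R : comNzRingType) (x h : R) n :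
  exists r, (x + h) ^+ n.+1 = x ^+ n.+1 + h * n.+1%:R * x ^+ n + h ^+ 2 * r.
Proof.
elim: n => [|n [r IHn]]; first by exists 0; rewrite !expr1 expr0; ring.
exists (n.+1%:R * x ^+ n + x * r + h * r).
by rewrite exprS IHn !exprS; ring.
Qed.

(** The functional is applied to a second-order expansion with integer coefficients; that z is an
    integer is what makes this a congruence modulo h^2. *)
Lemma euler_poly_taylor n (y h : int) : exists z : int,
  euler_poly n.+1 (y + h) =
  euler_poly n.+1 y + h * n.+1%:R * euler_poly n y + h ^+ 2 * z.
Proof.
have [r] := exprD_order2 ('X + y%:P) (h%:P) n.
rewrite -addrA -polyCD => Er; exists (euler_umbra r).
have eq_scale (c : int) (q : {poly int}) :
  euler_umbra (c%:P * q) = c * euler_umbra q by rewrite mul_polyC linearZ.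
rewrite /euler_poly Er 2!linearD /= -polyC_exp eq_scale.
by rewrite -(rmorph_nat polyC) /= -polyCM eq_scale.
Qed.

(** The summand is (-1)^j times the right-hand side of [euler_poly_step] at y = 2j, so the sum
    telescopes. *)
Lemma sum_alt_expr n N :
  \sum_(1 <= j < N.+1) (-1) ^+ j * (2 * (2 * j%:R) ^+ n) =
  (-1) ^+ N * euler_poly n (2 * N%:R + 1) - euler_poly n 1.
Proof.
elim: N => [|N IHN]; first by rewrite big_geq // expr0 mul1r mulr0 add0r subrr.
rewrite big_nat_recr //= IHN -euler_poly_step exprS.
have -> : 2 * N.+1%:R - 1 = 2 * N%:R + 1 :> int by lia.
by ring.
Qed.

(** Taylor expansion at 0 with increment 2N+1, which will be p. The constant of summation vanishes
    by [euler_poly1], and the linear term by [euler_odd]. *)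
Lemma sum_alt_expr_euler_even m N : ~~ odd m -> exists z : int,
  \sum_(1 <= j < N.+1) (-1) ^+ j * (2 * (2 * j%:R) ^+ m.+2) =
  (-1) ^+ N * euler m.+2 + (2 * N).+1%:R * z.
Proof.
have -> : (2 * N).+1%:R = 2 * N%:R + 1 :> int by lia.
move=> m_even; have [z Ez] := euler_poly_taylor m.+1 0 (2 * N%:R + 1).
exists ((-1) ^+ N * ((2 * N%:R + 1) * z)).
rewrite sum_alt_expr -[2 * N%:R + 1]add0r Ez !euler_poly0 euler_poly1 //=;
  last by rewrite negbK.
by rewrite (@euler_odd m.+1) // add0r; ring.
Qed.

(** Put P = 2N+1. At an odd exponent the constant c = [euler_poly m.+3 1] survives. Summing up to P
    gives -2c modulo P^2, as the linear term of the expansion at 1 vanishes by [euler_poly1];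
    subtracting this from twice the sum up to N removes c. *)
Lemma sum_alt_expr_euler_odd m N : ~~ odd m -> exists z : int,
  2 * \sum_(1 <= j < N.+1) (-1) ^+ j * (2 * (2 * j%:R) ^+ m.+3) =
  \sum_(1 <= j < (2 * N).+1) (-1) ^+ j * (2 * (2 * j%:R) ^+ m.+3) +
  2 * (-1) ^+ N * (2 * N).+1%:R * m.+3%:R * euler m.+2 +
  (2 * N).+1%:R ^+ 2 * z.
Proof.
move=> m_even; pose P : int := 2 * N%:R + 1.
have [z Ez] := euler_poly_taylor m.+2 0 P.
have [y Ey] := euler_poly_taylor m.+2 1 (2 * P).
have En := sum_alt_expr m.+3 N; rewrite -/P in En.
have Ep := sum_alt_expr m.+3 (2 * N).+1.
have PE : (2 * N).+1%:R = P by rewrite /P; lia.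
rewrite big_nat_recr //= PE [2 * P + 1]addrC Ey in Ep.
have sgn : (-1) ^+ (2 * N).+1 = -1 :> int by rewrite -signr_odd /= oddM.
rewrite sgn (@euler_poly1 m.+2) //= ?negbK // mulr0 addr0 in Ep.
rewrite add0r in Ez.
rewrite Ez !euler_poly0 (@euler_odd m.+3) ?add0r /= ?m_even // in En.
(* The last term j = P is a multiple of P^2, so the long sum may stop at 2N. *)
have EP : (2 * P) ^+ m.+3 = P ^+ 2 * (4 * (2 * P) ^+ m.+1) by rewrite !exprS;
  ring.
rewrite EP in Ep.
rewrite PE; exists (2 * (-1) ^+ N * z + 4 * y - 8 * (2 * P) ^+ m.+1).
by rewrite En -[\sum_(1 <= j < (2 * N).+1) _](addrK (-1 * (2 * (P ^+ 2 * (4 *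
  (2 * P) ^+ m.+1))))) Ep; ring.
Qed.

Lemma sum_alt_expr_intr m N :
  (\sum_(1 <= j < N) (-1) ^+ j * (2 * (2 * j%:R) ^+ m) : int)%:~R =
  \sum_(1 <= j < N) (-1) ^+ j * (2 * (2 * j%:R) ^+ m) :> rat.
Proof.
rewrite rmorph_sum; apply: eq_bigr => j _.
by rewrite !(rmorphM, rmorphXn, rmorph_sign, rmorph_nat).
Qed.

(** * Congruences between rational numbers *)

Section PrimeLocalization.

Variables (p : nat) (p_prime : prime p).

(* Z_(p), and below its ideal generated by p^m. *)
Definition Zloc : {pred rat} := fun x => p_integral p x.
Definition Zloc_ideal (m : nat) : {pred rat} :=
  fun x => x / p%:R ^+ m \in Zloc.

Lemma pR_neq0 : p%:R != 0 :> rat.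
Proof. by rewrite pnatr_eq0 -lt0n prime_gt0. Qed.

Lemma coprime_neq0 (d : nat) : coprime p d -> d%:R != 0 :> rat.
Proof.
rewrite pnatr_eq0; case: d => //; rewrite /coprime gcdn0 => /eqP p1.
by move: p_prime; rewrite p1.
Qed.

(** The fraction need not be reduced: by Gauss's lemma the reduced denominator divides d. Ring
    closure then only needs common denominators. *)
Lemma ZlocP x :
  reflect (exists a : int, exists2 d : nat, coprime p d & x = a%:~R / d%:R)
          (x \in Zloc).
Proof.
apply: (iffP idP) => [xp | [a [d pd ->]]].
  exists (numq x), `|denq x|%N => //; rewrite -[LHS]divq_num_den.
  by rewrite pmulrn absz_denq.
have d0 := coprime_neq0 pd; set y := _ / _.
have yd : numq y * d = a * denq y.
  apply: (@intr_inj rat); rewrite !intrM numqE mulrAC; congr (_ * _).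
  by rewrite /y divfK.
apply: coprime_dvdr pd; have := dvdz_mull a (dvdzz (denq y)).
rewrite -yd Gauss_dvdzr; last by rewrite coprimezE coprime_sym coprime_num_den.
by rewrite dvdzE.
Qed.

Lemma Zloc_subring : subring_closed Zloc.
Proof.
split=> [|x y /ZlocP[a [d pd ->]] /ZlocP[b [e pe ->]]
         |x y /ZlocP[a [d pd ->]] /ZlocP[b [e pe ->]]]; apply/ZlocP.
- by exists 1, 1%N; rewrite ?coprimen1 ?divr1.
- exists (a * e - b * d), (d * e)%N; rewrite ?coprimeMr ?pd //.
  have := coprime_neq0 pd; have := coprime_neq0 pe.
  rewrite intrD intrN !intrM natrM => *; field.
  by apply/andP.
exists (a * b), (d * e)%N; rewrite ?coprimeMr ?pd //.
have := coprime_neq0 pd; have := coprime_neq0 pe.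
by rewrite intrM natrM => *; field; apply/andP.
Qed.

HB.instance Definition _ := GRing.isSubringClosed.Build rat Zloc Zloc_subring.

Lemma Zloc_ideal_zmod m : zmod_closed (Zloc_ideal m).
Proof.
split=> [|x y]; first by rewrite unfold_in mul0r rpred0.
by rewrite ![_ \in Zloc_ideal m]unfold_in mulrBl; exact: rpredB.
Qed.

HB.instance Definition _ m :=
  GRing.isZmodClosed.Build rat (Zloc_ideal m) (Zloc_ideal_zmod m).

Lemma rat_congrE m a b : rat_congr p m a b = (a - b \in Zloc_ideal m).
Proof. by []. Qed.

Lemma Zloc_ideal0 x : (x \in Zloc_ideal 0) = (x \in Zloc).
Proof. by rewrite [LHS]unfold_in expr0 divr1. Qed.

Lemma Zloc_idealM m n x y :
  x \in Zloc_ideal m -> y \in Zloc_ideal n -> x * y \in Zloc_ideal (m + n)%N.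
Proof.
rewrite ![_ \in Zloc_ideal _]unfold_in => xm yn.
have -> : x * y / p%:R ^+ (m + n) =
  (x / p%:R ^+ m) * (y / p%:R ^+ n) by rewrite exprD invfM mulrACA.
exact: rpredM.
Qed.

Lemma Zloc_idealMr m x y :
  x \in Zloc_ideal m -> y \in Zloc -> x * y \in Zloc_ideal m.
Proof. by rewrite -Zloc_ideal0 -[in X in _ -> _ -> X](addn0 m);
  exact: Zloc_idealM. Qed.

Lemma Zloc_idealMl m x y :
  x \in Zloc -> y \in Zloc_ideal m -> x * y \in Zloc_ideal m.
Proof. by rewrite mulrC => *; exact: Zloc_idealMr. Qed.

Lemma Zloc_idealD m x y :
  x \in Zloc_ideal m -> y \in Zloc_ideal m -> x + y \in Zloc_ideal m.
Proof. exact: rpredD. Qed.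

Lemma Zloc_idealX m : p%:R ^+ m \in Zloc_ideal m.
Proof. by rewrite [_ \in _]unfold_in divff ?rpred1 // expf_neq0 ?pR_neq0. Qed.

Lemma Zloc_ideal1 : p%:R \in Zloc_ideal 1.
Proof. exact: (Zloc_idealX 1). Qed.

Lemma Zloc_ideal_le m n x :
  (m <= n)%N -> x \in Zloc_ideal n -> x \in Zloc_ideal m.
Proof.
move=> mn; rewrite ![_ \in Zloc_ideal _]unfold_in => xn.
have -> : x / p%:R ^+ m = x / p%:R ^+ n * p%:R ^+ (n - m).
  have p0 := pR_neq0; have -> : p%:R ^+ n = p%:R ^+ (n - m) * p%:R ^+ m :> rat.
    by rewrite -exprD subnK.
  by field; rewrite !expf_neq0.
by rewrite rpredM // rpredX // rpred_nat.
Qed.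

Lemma Zloc_ideal_Zloc m x : x \in Zloc_ideal m -> x \in Zloc.
Proof. by rewrite -Zloc_ideal0; exact: Zloc_ideal_le. Qed.

Lemma Zloc_nat (k : nat) : k%:R \in Zloc. Proof. exact: rpred_nat. Qed.
Lemma Zloc_int (k : int) : k%:~R \in Zloc. Proof. exact: rpred_int. Qed.

Lemma Zloc_natV k : ~~ (p %| k)%N -> (k%:R)^-1 \in Zloc.
Proof.
by move=> pk; apply/ZlocP; exists 1, k; rewrite ?div1r // prime_coprime.
Qed.

Lemma Zloc_ltV k : (0 < k < p)%N -> (k%:R)^-1 \in Zloc.
Proof.
by case/andP=> k0 kp; apply: Zloc_natV; rewrite gtnNdvd.
Qed.

Lemma Zloc_ideal_int m (a : int) :
  (p%:Z ^+ m %| a)%Z -> a%:~R \in Zloc_ideal m.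
Proof.
case/dvdzP=> b ->; rewrite intrM rmorphXn /=.
by rewrite Zloc_idealMl ?Zloc_idealX // Zloc_int.
Qed.

Lemma rat_congr_refl m a : a ≡ a %[modr p ^ m].
Proof. by rewrite rat_congrE subrr rpred0. Qed.

Lemma rat_congr_sym m a b : a ≡ b %[modr p ^ m] -> b ≡ a %[modr p ^ m].
Proof. by rewrite !rat_congrE -opprB rpredN. Qed.

Lemma rat_congr_trans m b a c :
  a ≡ b %[modr p ^ m] -> b ≡ c %[modr p ^ m] -> a ≡ c %[modr p ^ m].
Proof. by rewrite !rat_congrE => *; rewrite -(subrKA b) rpredD. Qed.

Lemma rat_congrD m a b c d : a ≡ b %[modr p ^ m] -> c ≡ d %[modr p ^ m] ->
  a + c ≡ b + d %[modr p ^ m].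
Proof. by rewrite !rat_congrE opprD addrACA; exact: rpredD. Qed.

Lemma rat_congrN m a b : a ≡ b %[modr p ^ m] -> - a ≡ - b %[modr p ^ m].
Proof. by rewrite !rat_congrE -opprD rpredN. Qed.

Lemma rat_congrB m a b c d : a ≡ b %[modr p ^ m] -> c ≡ d %[modr p ^ m] ->
  a - c ≡ b - d %[modr p ^ m].
Proof. by move=> *; apply: rat_congrD => //; exact: rat_congrN. Qed.

Lemma rat_congrMl m c a b : c \in Zloc ->
  a ≡ b %[modr p ^ m] -> c * a ≡ c * b %[modr p ^ m].
Proof. by rewrite !rat_congrE -mulrBr; exact: Zloc_idealMl. Qed.

Lemma rat_congrMr m c a b : c \in Zloc ->
  a ≡ b %[modr p ^ m] -> a * c ≡ b * c %[modr p ^ m].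
Proof. by rewrite ![_ * c]mulrC; exact: rat_congrMl. Qed.

Lemma rat_congrM m a b c d : b \in Zloc -> c \in Zloc ->
  a ≡ b %[modr p ^ m] -> c ≡ d %[modr p ^ m] -> a * c ≡ b * d %[modr p ^ m].
Proof.
move=> bp cp ab cd; apply: (@rat_congr_trans _ (b * c)).
  exact: rat_congrMr.
exact: rat_congrMl.
Qed.

Lemma rat_congr_Zloc m a b : a ≡ b %[modr p ^ m] -> b \in Zloc -> a \in Zloc.
Proof.
by rewrite rat_congrE => /Zloc_ideal_Zloc ab bp; rewrite -(subrK b a) rpredD.
Qed.

Lemma rat_congrX m a b k : b \in Zloc ->
  a ≡ b %[modr p ^ m] -> a ^+ k ≡ b ^+ k %[modr p ^ m].
Proof.
move=> bp ab; have ap := rat_congr_Zloc ab bp.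
elim: k => [|k IHk]; first by rewrite !expr0 rat_congr_refl.
by rewrite !exprS; apply: rat_congrM => //; rewrite rpredX.
Qed.

Lemma rat_congrV m (a b : rat) : a \in Zloc -> a^-1 \in Zloc -> b^-1 \in Zloc ->
  a != 0 -> b != 0 ->
  a ≡ b %[modr p ^ m] -> a^-1 ≡ b^-1 %[modr p ^ m].
Proof.
move=> ap aVp bVp a0 b0; rewrite !rat_congrE => ab.
have -> : a^-1 - b^-1 = (a - b) * - (a^-1 * b^-1).
  by field; rewrite ?a0 ?b0.
by rewrite Zloc_idealMr // rpredN rpredM.
Qed.

Lemma rat_congr_sum m (F G : nat -> rat) a b :
  (forall k, (a <= k < b)%N -> F k ≡ G k %[modr p ^ m]) ->
  \sum_(a <= k < b) F k ≡ \sum_(a <= k < b) G k %[modr p ^ m].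
Proof.
move=> FG; rewrite rat_congrE -sumrB big_nat_cond rpred_sum // => k.
by rewrite andbT; exact: FG.
Qed.

Lemma rat_congr_pM m n c a b : c \in Zloc_ideal n ->
  a ≡ b %[modr p ^ m] -> c * a ≡ c * b %[modr p ^ (n + m)%N].
Proof. by rewrite !rat_congrE -mulrBr; exact: Zloc_idealM. Qed.

Lemma rat_congr_le m n a b : (m <= n)%N ->
  a ≡ b %[modr p ^ n] -> a ≡ b %[modr p ^ m].
Proof. by rewrite !rat_congrE; exact: Zloc_ideal_le. Qed.

Lemma rat_congr_mod m (a b : nat) : a = b %[mod p ^ m] ->
  a%:R ≡ b%:R %[modr p ^ m].
Proof.
move=> /eqP ab; rewrite rat_congrE.
have -> : a%:R - b%:R = (a%:Z - b%:Z)%:~R :> rat by rewrite intrB.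
by apply: Zloc_ideal_int; rewrite -rmorphXn /= -eqz_mod_dvd !modz_nat.
Qed.

(** * Units of the localization at a prime p = 2n+1 above 3 *)

Variables (n : nat) (pE : p = (2 * n).+1) (n_gt1 : (1 < n)%N).

Lemma pRE : p%:R = 2 * n%:R + 1 :> rat.
Proof. by rewrite pE -natr1 natrM. Qed.

Lemma Zloc_binV N k : (k <= N < p)%N -> 'C(N, k)%:R^-1 \in Zloc.
Proof.
move=> /andP[kN Np]; apply: Zloc_natV => //.
have: ~~ (p %| N`!)%N.
  elim: N Np {kN} => [|N IHN] Np; first by rewrite dvdn1;
    case: eqP p_prime => // ->.
  by rewrite factS Euclid_dvdM // negb_or gtnNdvd //= IHN // ltnW.
by rewrite -(bin_fact kN) Euclid_dvdM // negb_or => /andP[].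
Qed.

Lemma Zloc_lt2pV m : (p < m < 2 * p)%N -> m%:R^-1 \in Zloc.
Proof.
move=> mp; apply: Zloc_natV; apply/negP => /dvdnP[[|[|c]] mE]; lia.
Qed.

Lemma Zloc_le4V k : (0 < k <= 4)%N -> k%:R^-1 \in Zloc.
Proof. by move=> k4; apply: Zloc_ltV; lia. Qed.

(** Proves p-integrality by descent through the expression. The inverses met at the leaves are those
    of integers at most 4, below p or strictly between p and 2p, of binomials from rows below p such
    as C(2k, k) with k <= n, or hypotheses. *)
Ltac zloc :=
  match goal with
  | H : ?P |- ?Q => constr_eq P Q; exact H
  | _ => idtac
  end;
  lazymatch goal with
  | |- is_true (_ * _ \in _) => apply: rpredM; zloc
  | |- is_true (_ + _ \in _) => apply: rpredD; zloc
  | |- is_true (- _ \in _) => rewrite rpredN; zloc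
  | |- is_true (_ ^+ _ \in _) => apply: rpredX; zloc
  | |- is_true ((_ ^+ _)^-1 \in _) => rewrite -exprVn; zloc
  | |- is_true ((_ * _)^-1 \in _) => rewrite invfM; zloc
  | |- is_true (0 \in _) => exact: rpred0
  | |- is_true (1 \in _) => exact: rpred1
  | |- is_true (_%:~R \in _) => exact: rpred_int
  | |- is_true (_%:R \in _) => exact: rpred_nat
  | |- is_true ((binomial _ _)%:R^-1 \in _) => apply: Zloc_binV; lia
  | |- is_true (_%:R^-1 \in _) =>
      first [apply: Zloc_le4V; exact: isT | apply: Zloc_ltV; lia
            | apply: Zloc_lt2pV; lia | assumption]
  | |- _ => idtac
  end.

(** A difference is not split, since it stands for a congruence unfolded by [rat_congrE]. *)
Ltac split_ideal :=
  lazymatch goal with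
  | |- is_true (_ - _ \in _) => idtac
  | |- is_true (_ + _ \in _) => apply: Zloc_idealD; split_ideal
  | |- _ => idtac
  end.

(** * Congruences for binomials and harmonic sums *)

(** Ratios of consecutive terms agree modulo p: -4(n-k) = 2(2k+1) - 2p. *)
Lemma central_bin_congr k : (k <= n)%N ->
  'C(2 * k, k)%:R ≡ (-4) ^+ k * 'C(n, k)%:R %[modr p ^ 1].
Proof.
elim: k => [|k IHk] kn; first by rewrite !bin0 mulr1 rat_congr_refl.
rewrite central_binrS binrSr exprS.
have kV : k.+1%:R^-1 \in Zloc by zloc.
have -> : -4 * (-4) ^+ k * ('C(n, k)%:R * (n%:R - k%:R) / k.+1%:R) =
  (-4) ^+ k * 'C(n, k)%:R * (2 * (2 * k%:R + 1) - 2 * p%:R) / k.+1%:R :> rat.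
  by rewrite pRE; ring.
apply: rat_congrMr => //; apply: rat_congrM => //.
- by zloc.
- by zloc.
- by apply: IHk; apply: ltnW.
rewrite rat_congrE opprB addrC subrK.
by apply: Zloc_idealMl; [zloc | exact: Zloc_ideal1].
Qed.

(** Again by ratios: -(n-k) = (n+k+1) - p. *)
Lemma bin_addn_congr k : (k <= n)%N ->
  'C(n + k, k)%:R ≡ (-1) ^+ k * 'C(n, k)%:R %[modr p ^ 1].
Proof.
elim: k => [|k IHk] kn; first by rewrite !bin0 mulr1 rat_congr_refl.
have kV : k.+1%:R^-1 \in Zloc by zloc.
rewrite addnS binrSS binrSr exprS.
have -> : -1 * (-1) ^+ k * ('C(n, k)%:R * (n%:R - k%:R) / k.+1%:R) =
  (-1) ^+ k * 'C(n, k)%:R * ((n + k).+1%:R - p%:R) / k.+1%:R :> rat.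
  by rewrite pRE; ring.
apply: rat_congrMr => //; apply: rat_congrM => //.
- by zloc.
- by zloc.
- by apply: IHk; apply: ltnW.
by rewrite rat_congrE opprB addrC subrK Zloc_ideal1.
Qed.

(** Euler's theorem, in the form that turns the positive powers summed by Euler polynomials into
    negative ones. *)
Lemma expr_totient_congr x m k e t : coprime x p ->
  (m + k = totient (p ^ e) * t)%N ->
  x%:R ^+ m ≡ (x%:R ^+ k)^-1 %[modr p ^ e].
Proof.
move=> xp mk; have x0 : x%:R != 0 :> rat.
  by apply: coprime_neq0 => //; rewrite coprime_sym.
have xV : x%:R^-1 \in Zloc.
  by apply: Zloc_natV => //; rewrite -prime_coprime // coprime_sym.
rewrite -[X in X ≡ _ %[modr _ ^ _]](mulfK (expf_neq0 k x0)) -exprD mk.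
rewrite -[X in _ ≡ X %[modr _ ^ _]]mul1r; apply: rat_congrMr; first by zloc.
rewrite -natrX; apply: (@rat_congr_mod _ _ 1).
by rewrite expnM -modnXm Euler_exp_totient ?coprimeXr // modnXm exp1n.
Qed.

Lemma sum_alt_totient_congr N m k e t : (N < p)%N -> (m + k = totient (p ^ e) *
  t)%N ->
  \sum_(1 <= j < N.+1) (-1) ^+ j * (2 * (2 * j%:R) ^+ m) ≡
  \sum_(1 <= j < N.+1) (-1) ^+ j * (2 / (2 * j%:R) ^+ k) %[modr p ^ e].
Proof.
move=> Nn mk; apply: rat_congr_sum => j /andP[j1 jN].
do 2!(apply: rat_congrMl; first by zloc).
rewrite -natrM; apply: expr_totient_congr mk => //.
by rewrite coprime_sym prime_coprime // Euclid_dvdM // !gtnNdvd //; lia.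
Qed.

Lemma totient_p : totient (p ^ 1) = (2 * n)%N.
Proof. by rewrite totient_pfactor // expn0 muln1 pE. Qed.

Lemma totient_p2 : totient (p ^ 2) = (2 * n * p)%N.
Proof. by rewrite totient_pfactor // expn1 pE. Qed.

(** The exponent m+2 is -2 modulo p-1. Keeping t free allows both m+2 = p-3 (t = 1) and m+2 =
    p(p-1)-2 (t = p), so that the two Euler numbers can be compared. *)
Lemma sum_alt_inv_sqr_congr m t : ~~ odd m -> (m.+4 = 2 * n * t)%N ->
  \sum_(1 <= j < n.+1) (-1) ^+ j / j%:R ^+ 2 ≡
  (-1) ^+ n * 2 * (euler m.+2)%:~R %[modr p ^ 1].
Proof.
move=> m_even mt; have [z Ez] := sum_alt_expr_euler_even n m_even.
have := sum_alt_totient_congr (k := 2) (e := 1) (t := t) (_ : n < p)%N.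
move=> /(_ m.+2); rewrite -sum_alt_expr_intr Ez totient_p addn2 => /(_ _ mt).
rewrite rmorphD !rmorphM rmorph_sign /= rmorph_nat -pE => H.
have -> : \sum_(1 <= j < n.+1) (-1) ^+ j / j%:R ^+ 2 =
  2 * \sum_(1 <= j < n.+1) (-1) ^+ j * (2 / (2 * j%:R) ^+ 2) :> rat.
  rewrite mulr_sumr; apply: eq_big_nat => j /andP[j1 _].
  by field; rewrite pnatr_eq0 -lt0n.
rewrite [_ * 2]mulrC -mulrA; apply: rat_congrMl; first by zloc.
apply: rat_congr_sym; apply: rat_congr_trans (H _); last by lia.
by rewrite rat_congrE opprD addNKr rpredN Zloc_idealMr ?Zloc_ideal1 //; zloc.
Qed.

(* Euler's summation at the exponent p(p-1)-1, once up to n and once up to p to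
   eliminate the constant of summation; the Euler number of index p(p-1)-2 that
   appears is replaced by E_(p-3), both being given modulo p by the same sum. *)
Lemma sum_alt_inv_congr :
  2 * (\sum_(1 <= j < n.+1) (-1) ^+ j / j%:R) ≡
  \sum_(1 <= j < p) (-1) ^+ j / j%:R -
  2 * (-1) ^+ n * p%:R * (euler (p - 3))%:~R %[modr p ^ 2].
Proof.
have n2 : (2 <= n)%N by [].
have [n' En] : exists n', n = n'.+2 by exists n.-2; lia.
(* This is the totient of p^2, so the exponent m+3 = t-1 inverts units modulo p^2. *)
pose t := (2 * n * p)%N.
have t_gt : (20 <= t)%N by rewrite /t pE En; lia.
have [m Em] : exists m, t = m.+4 by exists (t - 4)%N; lia.
have m_even : ~~ odd m by move: Em; rewrite /t; lia.
have [z] := sum_alt_expr_euler_odd n m_even.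
have HN := sum_alt_totient_congr (m := m.+3) (k := 1) (e := 2) (t := 1) (_ : n
  < p)%N.
have HP := sum_alt_totient_congr (m := m.+3) (k := 1) (e := 2) (t := 1) (_ : 2
  * n < p)%N.
have D1 : _ ≡ _ %[modr p ^ 1] := sum_alt_inv_sqr_congr m_even (esym Em).
have D2 := sum_alt_inv_sqr_congr (m := 2 * n') (t := 1) _.
rewrite oddM in D2; have {}D2 := D2 isT.
have Ep3 : (p - 3 = (2 * n').+2)%N by lia.
rewrite -Ep3 in D2; set E3 := euler (p - 3) in D2 *.
have EE : (euler m.+2)%:~R ≡ E3%:~R %[modr p ^ 1].
  have cancel_sign (x : rat) : (-1) ^+ n / 2 * ((-1) ^+ n * 2 * x) = x.
    by rewrite -[RHS]mul1r -[X in _ = X * _](sqrr_sign _ n); field.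
  rewrite -[X in X ≡ _ %[modr _ ^ _]]cancel_sign -[X in _ ≡ X %[modr _ ^
    _]]cancel_sign.
  apply: rat_congrMl; first by zloc.
  by apply: rat_congr_trans (D2 _); [exact: rat_congr_sym | lia].
move: HN HP; rewrite totient_p2 muln1 -/t Em addn1 => /(_ _ erefl) HN /(_ _
  erefl) HP.
rewrite -pE in HP *; rewrite -!sum_alt_expr_intr in HP HN.
set a := \sum_(1 <= j < n.+1) _ in HN *; set b := \sum_(1 <= j < p) _ in HP *.
have sumE N : \sum_(1 <= j < N) (-1) ^+ j * (2 / (2 * j%:R) ^+ 1) =
   \sum_(1 <= j < N) (-1) ^+ j / j%:R :> rat.
  apply: eq_big_nat => j /andP[j1 _].
  by field; rewrite pnatr_eq0 -lt0n.
rewrite !sumE in HP HN; move=> /(congr1 (intr : int -> rat)) Eab.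
set S := \sum_(1 <= j < n.+1) _ in HN *; set T := \sum_(1 <= j < p) _ in HP *.
(* Hence m+3 is -1 modulo p, which turns the coefficient 2 (-1)^n p (m+3) of the Euler number into
   -2 (-1)^n p modulo p^2. *)
have mE : m%:R = 2 * n%:R * p%:R - 4 :> rat.
  by rewrite -!natrM -/t Em -addn4 natrD addrK.
rewrite rat_congrE [X in X \in _](_ : _ = - 2 * (a%:~R - S) + (b%:~R - T) +
  p%:R * (2 * (-1) ^+ n) * (p%:R * (2 * n%:R * (euler m.+2)%:~R) -
    ((euler m.+2)%:~R - E3%:~R)) + p%:R ^+ 2 * z%:~R); last first.
  rewrite -[LHS]addr0 -[X in _ + X](subrr (2 * a)%:~R) {1}Eab.
  have -> : (-1) ^+ n = ((-1) ^+ n : int)%:~R :> rat by rewrite rmorph_sign.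
  move: (_ ^+ n) => s.
  by ring: mE.
split_ideal.
- apply: Zloc_idealMl; first by zloc.
  by apply: HN; rewrite pE; lia.
- by apply: HP; rewrite pE.
- rewrite -mulrA; apply: (@Zloc_idealM 1 1); first exact: Zloc_ideal1.
  apply: Zloc_idealMl; first by zloc.
  by rewrite rpredB // Zloc_idealMr ?Zloc_ideal1 //; zloc.
by apply: Zloc_idealMr; [exact: Zloc_idealX | zloc].
Qed.

Lemma subn_inv_congr k : (0 < k < p)%N ->
  ((p - k)%:R)^-1 ≡ - (k%:R)^-1 %[modr p ^ 1].
Proof.
move=> kp; have k0 : k%:R != 0 :> rat by rewrite pnatr_eq0; lia.
rewrite -invrN; apply: rat_congrV => //; try by rewrite ?invrN; zloc.
- by rewrite pnatr_eq0; lia.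
- by rewrite oppr_eq0.
rewrite natrB; last by lia.
by rewrite rat_congrE opprK subrK Zloc_ideal1.
Qed.

Lemma subn_sqr_inv_congr k : (0 < k < p)%N ->
  ((p - k)%:R ^+ 2)^-1 ≡ (k%:R ^+ 2)^-1 %[modr p ^ 1].
Proof.
move=> kp; rewrite -!exprVn -[X in _ ≡ X %[modr _ ^ _]]sqrrN.
apply: rat_congrX; first by zloc.
exact: subn_inv_congr.
Qed.

(* With h the half sum, reflection makes the full sum 2h and kills the
   alternating one, so the even terms sum to h; termwise they sum to h/4. *)
Lemma sum_inv_sqr_congr0_both :
  \sum_(1 <= k < n.+1) (k%:R ^+ 2)^-1 ≡ 0 %[modr p ^ 1] /\
  \sum_(1 <= k < p) (k%:R ^+ 2)^-1 ≡ 0 %[modr p ^ 1].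
Proof.
set h := \sum_(_ <= _ < _) _.
have cut (F : nat -> rat) : \sum_(1 <= k < p) F k =
    \sum_(1 <= k < n.+1) F k + \sum_(1 <= k < n.+1) F (p - k)%N.
  by rewrite {2}pE -big_reflect pE -big_cat_nat //=; lia.
have Zh : \sum_(1 <= k < p) (k%:R ^+ 2)^-1 ≡ 2 * h %[modr p ^ 1].
  rewrite cut mulr_natl mulr2n; apply: rat_congrD; first exact: rat_congr_refl.
  by apply: rat_congr_sum => k kn; apply: subn_sqr_inv_congr; lia.
have A0 : \sum_(1 <= k < p) (-1) ^+ k * (k%:R ^+ 2)^-1 ≡ 0 %[modr p ^ 1].
  rewrite cut -[X in _ ≡ X %[modr _ ^ _]](subrr
    (\sum_(1 <= k < n.+1) (-1) ^+ k * (k%:R ^+ 2)^-1)).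
  apply: rat_congrD; first exact: rat_congr_refl.
  rewrite -sumrN; apply: rat_congr_sum => k kn.
  rewrite -mulNr -signr_odd oddB; last by lia.
  have -> : odd p by rewrite pE /= oddM.
  rewrite addTb signrN signr_odd.
  apply: rat_congrMl; first by zloc.
  by apply: subn_sqr_inv_congr; lia.
have E := sum_even (fun k => (k%:R ^+ 2)^-1) n.
have hE : 2 * \sum_(1 <= k < n.+1) ((2 * k)%:R ^+ 2)^-1 = h / 2 :> rat.
  rewrite mulr_sumr mulr_suml; apply: eq_big_nat => k /andP[k1 _].
  by rewrite natrM; field; rewrite pnatr_eq0 -lt0n.
rewrite hE -pE in E.
rewrite (eq_bigr (fun k => (k%:R ^+ 2)^-1 + (-1) ^+ k * (k%:R ^+ 2)^-1)) in E;
  last first.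
  by move=> k _; rewrite mulrDl mul1r.
rewrite big_split /= in E.
have := rat_congrB (rat_congrD Zh A0) (rat_congr_refl 1 (h / 2)).
rewrite E subrr addr0 => H0.
have h0 : h ≡ 0 %[modr p ^ 1].
  (* The factor 3/2 is a unit because p > 3. *)
  have -> : h = (2 / 3) * (2 * h - h / 2) by field.
  rewrite -[X in _ ≡ X %[modr _ ^ _]](mulr0 (2 / 3)); apply: rat_congrMl;
    first by zloc.
  exact: rat_congr_sym.
split=> //; apply: (rat_congr_trans Zh).
by rewrite -(mulr0 2); apply: rat_congrMl; first by zloc.
Qed.

Lemma sum_half_inv_sqr_congr0 :
  \sum_(1 <= k < n.+1) (k%:R ^+ 2)^-1 ≡ 0 %[modr p ^ 1].
Proof. by case: sum_inv_sqr_congr0_both. Qed.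

Lemma sum_inv_sqr_congr0 :
  \sum_(1 <= k < p) (k%:R ^+ 2)^-1 ≡ 0 %[modr p ^ 1].
Proof. by case: sum_inv_sqr_congr0_both. Qed.

(** C(ap-1, j) is (-1)^j times the product of 1 - ap/i over 1 <= i <= j, expanded to first order in
    p. *)
Lemma bin_pred_congr a j : (0 < a)%N -> (j < p)%N ->
  'C((a * p).-1, j)%:R ≡
  (-1) ^+ j * (1 - a%:R * p%:R * \sum_(1 <= i < j.+1) (i%:R)^-1) %[modr p ^ 2].
Proof.
move=> a0; elim: j => [|j IHj] jp.
  by rewrite bin0 big_geq // mulr0 subr0 mulr1 rat_congr_refl.
rewrite binrSr big_nat_recr //= exprS.
set H := \sum_(_ <= _ < _) _ in IHj *.
have j0 : j.+1%:R != 0 :> rat by rewrite pnatr_eq0.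
have -> : 'C((a * p).-1, j)%:R * ((a * p).-1%:R - j%:R) / j.+1%:R =
  'C((a * p).-1, j)%:R * - (1 - a%:R * p%:R / j.+1%:R) :> rat.
  have -> : (a * p).-1%:R = a%:R * p%:R - 1 :> rat.
    by rewrite -natrM -[in RHS](prednK (_ : 0 < a * p)%N) ?muln_gt0 ?a0
      ?prime_gt0 // -natr1 addrK.
  by field; rewrite nat1r.
have Hp : H \in Zloc.
  rewrite /H big_nat_cond rpred_sum // => i; rewrite andbT => ij.
  by zloc.
apply: (rat_congr_trans _ (_ : (-1) ^+ j * (1 - a%:R * p%:R * H) * - (1 - a%:R
  * p%:R / j.+1%:R) ≡ _ %[modr p ^ 2])).
  apply: rat_congrMr; first by zloc.
  by apply: IHj; lia.
rewrite rat_congrE [X in X \in _](_ : _ = p%:R ^+ 2 * (- (-1) ^+ j * (a%:R ^+ 2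
  * H / j.+1%:R))).
  by apply: Zloc_idealMr; [exact: Zloc_idealX | zloc].
by field; rewrite nat1r.
Qed.

(** C(ap, k) = (ap/k) C(ap-1, k-1), and the factor p gains one power in the modulus. *)
Lemma bin_mulp_congr a k : (0 < a)%N -> (0 < k < p)%N ->
  'C(a * p, k)%:R ≡ - (-1) ^+ k * (a%:R * p%:R / k%:R) *
  (1 - a%:R * p%:R * \sum_(1 <= i < k) (i%:R)^-1) %[modr p ^ 3].
Proof.
case: k => // k a0 kp; have ap0 : (0 < a * p)%N by rewrite muln_gt0 a0
  prime_gt0.
rewrite -[in X in X ≡ _ %[modr _ ^ _]](prednK ap0) binrSS prednK // natrM.
rewrite exprS mulN1r opprK -[_ * _ / _]mulrA [_ * (_ / _)]mulrC.
rewrite [X in _ ≡ X * _ %[modr _ ^ _]]mulrC -[X in _ ≡ X %[modr _ ^ _]]mulrA.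
apply: (@rat_congr_pM 2 1); first by rewrite mulrAC Zloc_idealMl ?Zloc_ideal1
  //; zloc.
by apply: bin_pred_congr => //; lia.
Qed.

(** In C(ap, k) the harmonic term carries a^2 p^2, so the weight 4 cancels it between a = 2 and a =
    1; the linear terms leave 2p - 4p. *)
Lemma bin_2p_congr k : (0 < k < p)%N ->
  'C(2 * p, k)%:R - 4 * 'C(p, k)%:R ≡ (-1) ^+ k * (2 * p%:R / k%:R) %[modr p ^
    3].
Proof.
move=> kp; have H2 := bin_mulp_congr (isT : 0 < 2)%N kp.
have := bin_mulp_congr (isT : 0 < 1)%N kp; rewrite mul1n => H1.
have H4 : 4 \in Zloc by zloc.
have := rat_congrB H2 (rat_congrMl H4 H1).
by congr rat_congr; ring.
Qed.

Lemma bin_p_pred_congr k : (k < p)%N -> 'C(p.-1, k)%:R ≡ (-1) ^+ k %[modr p ^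
  1].
Proof.
move=> kp; have := bin_pred_congr (isT : 0 < 1)%N kp; rewrite mul1n => H.
have {}H := rat_congr_le (isT : 1 <= 2)%N H; apply: (rat_congr_trans H).
set s := \sum_(_ <= _ < _) _.
have sp : s \in Zloc.
  by rewrite /s big_nat_cond rpred_sum // => i; rewrite andbT => ij; zloc.
rewrite rat_congrE [X in X \in _](_ : _ = p%:R * - ((-1) ^+ k * s));
  last by ring.
by apply: Zloc_idealMr; [exact: Zloc_ideal1 | zloc].
Qed.

Lemma sqr_bin_p_congr k : (0 < k < p)%N ->
  'C(p, k)%:R ^+ 2 ≡ p%:R ^+ 2 * (k%:R ^+ 2)^-1 %[modr p ^ 3].
Proof.
case: k => // k kp; rewrite -[in X in X ≡ _ %[modr _ ^ _]](prednK (prime_gt0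
  p_prime)).
rewrite binrSS prednK ?prime_gt0 //.
have -> : ('C(p.-1, k)%:R * p%:R / k.+1%:R) ^+ 2 =
  p%:R ^+ 2 * ((k.+1%:R ^+ 2)^-1 * 'C(p.-1, k)%:R ^+ 2) :> rat.
  by rewrite !exprMn -exprVn mulrC; ring.
apply: (@rat_congr_pM 1 2); first exact: Zloc_idealX.
rewrite -[X in _ ≡ X %[modr _ ^ _]]mulr1; apply: rat_congrMl; first by zloc.
rewrite -[X in _ ≡ X %[modr _ ^ _]](sqrr_sign _ k); apply: rat_congrX;
  first by zloc.
by apply: bin_p_pred_congr; lia.
Qed.

(** A form of Wolstenholme's theorem. By Vandermonde this is the sum of C(p, j)^2: the end terms
    give 2, the others p^2 times a sum of 1/k^2 that p divides. *)
Lemma central_bin_p_congr : 'C(2 * p, p)%:R ≡ 2 %[modr p ^ 3].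
Proof.
rewrite mul2n -addnn -binomial.Vandermonde natr_sum.
rewrite -(big_mkord xpredT (fun j => ('C(p, j) * 'C(p, p - j))%:R)).
rewrite big_ltn // big_nat_recr ?prime_gt0 //= bin0 subn0 subnn binn bin0.
rewrite [X in _ + X]addrC addrA -[X in _ ≡ X %[modr _ ^ _]]addr0.
apply: rat_congrD; first exact: rat_congr_refl.
apply: (@rat_congr_trans _ (\sum_(1 <= k < p) p%:R ^+ 2 * (k%:R ^+ 2)^-1)).
  apply: rat_congr_sum => k kp; rewrite bin_sub; last by lia.
  by rewrite natrM -expr2; apply: sqr_bin_p_congr.
rewrite -mulr_sumr -[X in _ ≡ X %[modr _ ^ _]](mulr0 (p%:R ^+ 2));
  apply: (@rat_congr_pM 1 2).
  exact: Zloc_idealX.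
exact: sum_inv_sqr_congr0.
Qed.

Lemma sum_bin_2p : 2 * (\sum_(0 <= k < p) 'C(2 * p, k)%:R) + 'C(2 * p, p)%:R
  = 2 ^+ (2 * p) :> rat.
Proof.
have -> : 2 ^+ (2 * p) = \sum_(0 <= k < (2 * p).+1) 'C(2 * p, k)%:R :> rat.
  rewrite -[2]/(1 + 1) exprDn big_mkord; apply: eq_bigr => k _.
  by rewrite !expr1n mulr1.
have p2 : (p.+1 <= (2 * p).+1)%N by lia.
rewrite (big_cat_nat (leq0n _) p2) /=.
rewrite big_reflect big_nat_recr //=.
rewrite [X in _ = _ + X]big_add1 /=.
rewrite [X in _ = _ + X](eq_big_nat _ _ (F2 := fun k => 'C(2 * p, k)%:R));
  last first.
  move=> k kp; rewrite -[in RHS]bin_sub; last by lia.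
  by congr ('C(_, _)%:R); lia.
by ring.
Qed.

Local Notation w := (2 ^+ (2 * n) : rat).

(** [bin_2p_congr] is summed over k. With w = 2^(p-1), row p contributes 2w - 2 and half of row 2p
    contributes 2w^2 - 2 modulo p^3; then 2w^2 - 2 - 4(2w - 2) = 2(w-1)(w-3). *)
Lemma sum_alt_inv_fermat : p%:R * (\sum_(1 <= k < p) (-1) ^+ k / k%:R) ≡
  (w - 1) * (w - 3) %[modr p ^ 3].
Proof.
have S1 : \sum_(1 <= k < p) ('C(2 * p, k)%:R - 4 * 'C(p, k)%:R) ≡
    \sum_(1 <= k < p) (-1) ^+ k * (2 * p%:R / k%:R) %[modr p ^ 3].
  by apply: rat_congr_sum => k kp; apply: bin_2p_congr.
rewrite sumrB -mulr_sumr in S1.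
have E1 : \sum_(1 <= k < p) 'C(p, k)%:R = 2 * w - 2 :> rat.
  rewrite -exprS -pE -[in RHS](_ : 1 + 1 = 2) // exprDn.
  rewrite -(big_mkord xpredT (fun i => 1 ^+ (p - i) * 1 ^+ i *+ 'C(p, i))).
  rewrite big_ltn // big_nat_recr ?prime_gt0 //= !expr1n binn bin0 !mulr1.
  rewrite [in RHS](eq_bigr (fun k => 'C(p, k)%:R)); last by move=> k _;
    rewrite !expr1n mulr1.
  by ring.
have E2 := sum_bin_2p; rewrite big_ltn ?prime_gt0 // bin0 in E2.
have wE : 2 ^+ (2 * p) = 4 * w ^+ 2 :> rat.
  have -> : 4 = 2 ^+ 2 :> rat by ring.
  by rewrite -exprM -exprD; congr (_ ^+ _); lia.
rewrite wE in E2.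
rewrite E1 in S1; set B := \sum_(1 <= k < p) 'C(2 * p, k)%:R in S1 E2.
have S1E : \sum_(1 <= k < p) (-1) ^+ k * (2 * p%:R / k%:R) =
    2 * (p%:R * \sum_(1 <= k < p) (-1) ^+ k / k%:R) :> rat.
  by rewrite !mulr_sumr; apply: eq_bigr => k _; ring.
rewrite S1E in S1; set T := p%:R * _ in S1 *.
have := central_bin_p_congr; rewrite rat_congrE => HC.
have BE : B = (4 * w ^+ 2 - 'C(2 * p, p)%:R) / 2 - 1.
  by rewrite -E2; field.
apply: rat_congr_sym; rewrite rat_congrE.
have -> : (w - 1) * (w - 3) - T =
  2^-1 * (B - 4 * (2 * w - 2) - 2 * T) + 4^-1 * ('C(2 * p, p)%:R - 2).
  by rewrite BE; field.
apply: Zloc_idealD; apply: Zloc_idealMl => //; try by zloc.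
Qed.

Lemma fermat_pow2_congr : w ≡ 1 %[modr p ^ 1].
Proof.
have := expr_totient_congr (x := 2) (m := 2 * n) (k := 0) (e := 1) (t := 1).
rewrite expr0 invr1; apply; last by rewrite totient_p; lia.
by rewrite coprime_sym prime_coprime // gtnNdvd; lia.
Qed.

(** * The five congruences *)

Lemma sum_central_bin_pow2_congr :
  \sum_(0 <= k < p) 'C(2 * k, k)%:R / 2 ^+ k ≡
  (-1) ^+ n - p%:R ^+ 2 * (euler (p - 3))%:~R %[modr p ^ 3].
Proof.
set Sg := \sum_(_ <= _ < _) _; set E := (euler _)%:~R.
pose X := \sum_(0 <= k < p) 'C(2 * p, k)%:R * re_iX k.
(* This is Re (1+i)^p: the omitted term k = p is zero because p is odd. *)
pose a := \sum_(0 <= k < p) 'C(p, k)%:R * re_iX k.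
pose s : rat := (-1) ^+ n.
(* Since p-k+1 = 2(n+1)-k, the weights in [sum_central_bin_pow2] are [re_iX k] up to the sign
   (-1)^(n+1). *)
have wX : w * Sg = s * X.
  have := sum_central_bin_pow2 p; rewrite -/Sg {1}pE exprS => H.
  have {}H : w * Sg = - \sum_(0 <= k < p) 'C(2 * p, k)%:R * re_iX (p - k).+1.
    by apply: (@mulfI _ 2) => //; rewrite mulrA H; ring.
  rewrite H /X mulr_sumr -sumrN; apply: eq_big_nat => k kp.
  have -> : ((p - k).+1 = 2 * n.+1 - k)%N by lia.
  by rewrite re_iX_subl ?exprS -?/s; [ring | lia].
have a2 : a ^+ 2 = w.
  rewrite -sqr_sum_bin_re_iX big_nat_recr //= -pE /a.
  by rewrite (@re_iX_odd p) ?mulr0 ?addr0 // pE /= oddM.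
have re0 : re_iX 0 = 1 by [].
have aE : a = 1 + \sum_(1 <= k < p) 'C(p, k)%:R * re_iX k.
  by rewrite /a big_ltn ?prime_gt0 // bin0 re0 mulr1.
have XE : X = 1 + \sum_(1 <= k < p) 'C(2 * p, k)%:R * re_iX k.
  by rewrite /X big_ltn ?prime_gt0 // bin0 re0 mulr1.
have re_loc k : re_iX k \in Zloc by rewrite /re_iX; case: ifP => _; zloc.
have a1 : a - 1 \in Zloc_ideal 1.
  rewrite aE addrC addrA addNr add0r big_nat_cond rpred_sum // => k;
    rewrite andbT => kp.
  apply: Zloc_idealMr; last exact: re_loc.
  have /dvdnP[c ->] := prime_dvd_bin p_prime kp.
  by rewrite natrM; apply: Zloc_idealMl; [zloc | exact: Zloc_ideal1].
pose S : rat := \sum_(1 <= j < n.+1) (-1) ^+ j / j%:R.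
have XaS : X ≡ 1 + 4 * (a - 1) + p%:R * S %[modr p ^ 3].
  (* Only even k contribute, and k = 2j gives (-1)^j p/j. *)
  have -> : p%:R * S = \sum_(1 <= k < p) (-1) ^+ k * (2 * p%:R / k%:R) * re_iX
    k.
    have := sum_even (fun k => p%:R / k%:R * re_iX k) n; rewrite -pE => H.
    rewrite [RHS](eq_bigr (fun k => (1 + (-1) ^+ k) * (p%:R / k%:R * re_iX
      k))); last first.
      move=> k _; have [k_odd|k_even] := boolP (odd k).
        by rewrite re_iX_odd // !mulr0.
      by rewrite -signr_odd (negbTE k_even) expr0; ring.
    rewrite H /S !mulr_sumr; apply: eq_big_nat => k /andP[k1 _].
    by rewrite re_iX_double natrM; field; rewrite pnatr_eq0 -lt0n.
  rewrite rat_congrE XE aE.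
  have -> (x y z : rat) : 1 + x - (1 + 4 * (1 + y - 1) + z) = x - 4 * y - z by
    ring.
  rewrite mulr_sumr -!sumrB big_nat_cond rpred_sum // => k; rewrite andbT => kp.
  have -> (x y z r : rat) : x * r - 4 * (y * r) - z * r = (x - 4 * y - z) * r
    by ring.
  by apply: Zloc_idealMr; [exact: bin_2p_congr | exact: re_loc].
have T3 := sum_alt_inv_fermat; have S2 := sum_alt_inv_congr.
rewrite -/S -/E -/s in S2; set T := \sum_(1 <= k < p) _ in T3 S2.
have w1 := fermat_pow2_congr; have wV : w^-1 \in Zloc by zloc.
have E_loc : E \in Zloc by rewrite /E; zloc.
have s2 : s ^+ 2 = 1 by rewrite sqrr_sign.
have w0 : w != 0 by rewrite expf_neq0.
have s_loc : s \in Zloc by rewrite /s; zloc.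
have a0 : a != 0 by rewrite -sqrf_eq0 a2.
have a_loc : a \in Zloc by rewrite -(subrK 1 a) rpredD ?rpred1 //
  (Zloc_ideal_Zloc a1).
have SgE : Sg = w^-1 * (s * X) by rewrite -wX mulKf.
rewrite rat_congrE SgE.
(* a = 1 modulo p is a triple root of the polynomial in a that remains. *)
have -> : w^-1 * (s * X) - (s - p%:R ^+ 2 * E) = w^-1 * s *
  ((X - (1 + 4 * (a - 1) + p%:R * S)) + 2^-1 * (p%:R * (2 * S - (T - 2 * s *
    p%:R * E)))
   + 2^-1 * (p%:R * T - (w - 1) * (w - 3)) + 2^-1 * ((a - 1) ^+ 3 * (a + 3))
   + p%:R ^+ 2 * (w - 1) * (s * E)) + p%:R ^+ 2 * E * (1 - s ^+ 2).
  by rewrite -a2; field.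
rewrite s2 subrr mulr0 addr0.
apply: Zloc_idealMl; first by zloc.
have I3 x : x \in Zloc_ideal 2 -> p%:R * x \in Zloc_ideal 3.
  by move=> x2; apply: (@Zloc_idealM 1 2) => //; exact: Zloc_ideal1.
split_ideal.
- exact: XaS.
- by apply: Zloc_idealMl; [zloc | exact: I3].
- by apply: Zloc_idealMl; [zloc | exact: T3].
- apply: Zloc_idealMl; first by zloc.
  apply: Zloc_idealMr; last by zloc.
  by rewrite exprS; apply: (@Zloc_idealM 1 2) => //; apply: (@Zloc_idealM 1 1).
apply: Zloc_idealMr; last by zloc.
by apply: (@Zloc_idealM 2 1) => //; exact: Zloc_idealX.
Qed.

Lemma sum_alt_inv_sqr_euler_congr : \sum_(1 <= j < n.+1) (-1) ^+ j / j%:R ^+ 2 ≡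
  (-1) ^+ n * 2 * (euler (p - 3))%:~R %[modr p ^ 1].
Proof.
have [m Em] : exists m, n = m.+2 by exists n.-2; lia.
have -> : (p - 3 = (2 * m).+2)%N by lia.
by apply: (@sum_alt_inv_sqr_congr _ 1); [rewrite oddM | lia].
Qed.

Lemma inv_central_bin_congr k : (k <= n)%N ->
  ('C(2 * k, k)%:R)^-1 ≡ ((-4) ^+ k * 'C(n, k)%:R)^-1 %[modr p ^ 1].
Proof.
move=> kn; have m4 : (- 4)^-1 \in Zloc by rewrite invrN; zloc.
apply: rat_congrV.
- by zloc.
- by zloc.
- by zloc.
- by apply: binr_neq0; lia.
- by rewrite mulf_neq0 ?binr_neq0 // expf_neq0.
exact: central_bin_congr.
Qed.

Lemma sum_pow4_inv_central_bin_congr :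
  \sum_(1 <= k < n.+1) 4 ^+ k / (k%:R ^+ 2 * 'C(2 * k, k)%:R) ≡
  (-1) ^+ n * 4 * (euler (p - 3))%:~R %[modr p ^ 1].
Proof.
apply: (@rat_congr_trans _ (\sum_(1 <= k < n.+1) (-1) ^+ k / (k%:R ^+ 2 * 'C(n,
  k)%:R))).
  apply: rat_congr_sum => k kn.
  have c0 : 'C(n, k)%:R != 0 :> rat by apply: binr_neq0; lia.
  have k0 : k%:R != 0 :> rat by rewrite pnatr_eq0; lia.
  have -> : (-1) ^+ k / (k%:R ^+ 2 * 'C(n, k)%:R) =
      4 ^+ k / k%:R ^+ 2 * ((-4) ^+ k * 'C(n, k)%:R)^-1 :> rat.
    have -> : (-4) ^+ k = (-1) ^+ k * 4 ^+ k :> rat by rewrite -exprMn mulN1r.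
    rewrite -[in LHS](invr_sign _ k).
    by field; rewrite c0 k0 signr_eq0 expf_neq0.
  rewrite invfM mulrA; apply: rat_congrMl; first by zloc.
  by apply: inv_central_bin_congr; lia.
rewrite sum_alt_inv_bin.
have -> : \sum_(1 <= k < n.+1) (1 + 2 * (-1) ^+ k) / k%:R ^+ 2 =
  \sum_(1 <= k < n.+1) (k%:R ^+ 2)^-1 +
  2 * \sum_(1 <= k < n.+1) (-1) ^+ k / k%:R ^+ 2 :> rat.
  by rewrite mulr_sumr -big_split; apply: eq_bigr => k _ /=;
    rewrite mulrDl mul1r mulrA.
have -> : (-1) ^+ n * 4 * (euler (p - 3))%:~R =
  0 + 2 * ((-1) ^+ n * 2 * (euler (p - 3))%:~R) :> rat by ring.
apply: rat_congrD; first exact: sum_half_inv_sqr_congr0.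
by apply: rat_congrMl; [zloc | exact: sum_alt_inv_sqr_euler_congr].
Qed.

Lemma subn_natr_congr (a c : nat) : (c <= a * p)%N -> (a * p - c)%:R ≡ - c%:R
  %[modr p ^ 1].
Proof.
move=> cp; rewrite natrB // natrM rat_congrE opprK subrK.
by apply: Zloc_idealMl; [zloc | exact: Zloc_ideal1].
Qed.

(** Induction on k, comparing ratios of consecutive terms modulo p; the division by p makes both
    sides p-integral, and the base case rests on C(2p, p) being 2 modulo p. *)
Lemma central_bin_reflect_congr k : (0 < k <= n)%N ->
  'C(2 * (p - k), p - k)%:R / ((p - k)%:R * p%:R) ≡
  2 / (k%:R ^+ 2 * 'C(2 * k, k)%:R) %[modr p ^ 1].
Proof.
case: k => // k; elim: k => [_|k IHk kn].
  rewrite expr1n mul1r bin1 divff //.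
  have := central_binrS p.-1; rewrite prednK ?prime_gt0 // subn1 => H.
  have p1 : p.-1%:R = p%:R - 1 :> rat by rewrite -subn1 natrB ?prime_gt0.
  have p10 : p.-1%:R != 0 :> rat by rewrite pnatr_eq0; lia.
  have p20 : 2 * p.-1%:R + 1 != 0 :> rat by rewrite -natrM natr1 pnatr_eq0.
  have -> : 'C(2 * p.-1, p.-1)%:R / (p.-1%:R * p%:R) =
     'C(2 * p, p)%:R / 2 * ((2 * p.-1).+1%:R^-1 * p.-1%:R^-1) :> rat.
    have -> : (2 * p.-1).+1%:R = 2 * p.-1%:R + 1 :> rat by rewrite -natrM natr1.
    by rewrite H; field; rewrite p10 p20 pR_neq0.
  (* The value 1 is written so as to match C(2p, p)/2, 1/(2p-1) and 1/(p-1) factor by factor. *)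
  rewrite [X in _ ≡ X %[modr _ ^ _]](_ : _ = 2 / 2 * ((-1)^-1 * (-1)^-1)) //.
  have N1 : (-1)^-1 \in Zloc by rewrite invrN1; zloc.
  have dv : (2 * p.-1).+1%:R^-1 \in Zloc by apply: Zloc_lt2pV; lia.
  apply: rat_congrM; [by zloc | by zloc | |].
    apply: rat_congrMr; first by zloc.
    exact: (rat_congr_le (isT : 1 <= 3)%N central_bin_p_congr).
  apply: rat_congrM; [by zloc | by zloc | |].
    apply: rat_congrV => //; [by zloc | by rewrite pnatr_eq0 |].
    have -> : (2 * p.-1).+1 = (2 * p - 1)%N by lia.
    by apply: (@subn_natr_congr _ 1); lia.
  apply: rat_congrV => //; [by zloc | by zloc |].
  have -> : p.-1 = (1 * p - 1)%N by lia.
  by apply: (@subn_natr_congr _ 1); lia.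
have kp : (0 < k.+1 < p)%N by lia.
have H := central_binrS (p - k.+2); rewrite (_ : (p - k.+2).+1 = p - k.+1)%N in
  H; last by lia.
set j := (p - k.+2)%N in H *.
have j0 : j%:R != 0 :> rat by rewrite pnatr_eq0 /j; lia.
have jE : (p - k.+1)%:R = j%:R + 1 :> rat by rewrite natr1; congr _%:R; lia.
have j10 : 1 + j%:R != 0 :> rat by rewrite nat1r pnatr_eq0.
have j20 : 2 * j%:R + 1 != 0 :> rat by rewrite -natrM natr1 pnatr_eq0.
(* The ratio is (j+1)^2 / (2(2j+1)j). Modulo p, j+1, 2j+1 and j become -(k+1), -(2k+3) and -(k+2),
   which gives the ratio on the other side. *)
have -> : 'C(2 * j, j)%:R / (j%:R * p%:R) =
  'C(2 * (p - k.+1), p - k.+1)%:R / ((p - k.+1)%:R * p%:R) *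
  ((p - k.+1)%:R ^+ 2 / 2 * ((2 * j + 1)%:R^-1 * j%:R^-1)) :> rat.
  have -> : (2 * j + 1)%:R = 2 * j%:R + 1 :> rat by rewrite -natrM natr1 addn1.
  by rewrite H jE; field; rewrite j0 j20 pR_neq0 addrC.
have c0 : 'C(2 * k.+1, k.+1)%:R != 0 :> rat by apply: binr_neq0; lia.
have -> : 2 / (k.+2%:R ^+ 2 * 'C(2 * k.+2, k.+2)%:R) =
  2 / (k.+1%:R ^+ 2 * 'C(2 * k.+1, k.+1)%:R) *
  ((- k.+1%:R) ^+ 2 / 2 * ((- (2 * k.+1 + 1)%:R)^-1 * (- k.+2%:R)^-1)) :> rat.
  have k1 : k.+1%:R != 0 :> rat by rewrite pnatr_eq0.
  have k2 : k.+2%:R != 0 :> rat by rewrite pnatr_eq0.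
  have k3 : (2 * k.+1 + 1)%:R != 0 :> rat by rewrite addn1 pnatr_eq0.
  have -> : (2 * k.+1 + 1)%:R = 2 * k.+1%:R + 1 :> rat by rewrite -natrM natr1
    addn1.
  rewrite central_binrS; field.
  by rewrite c0 nat1r k1 -[2 + _]natrD k2 -natrM natr1 pnatr_eq0.
have dv : (2 * j + 1)%:R^-1 \in Zloc by apply: Zloc_lt2pV; lia.
apply: rat_congrM; [by zloc | by zloc | by apply: IHk; lia |].
apply: rat_congrM; [by zloc | by zloc | |].
  apply: rat_congrMr; first by zloc.
  apply: rat_congrX; first by zloc.
  by rewrite -[p in (p - _)%N]mul1n; apply: subn_natr_congr; lia.
apply: rat_congrM; [by rewrite invrN; zloc | by zloc | |].
  apply: rat_congrV => //; [by zloc | by rewrite invrN;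
    zloc | by rewrite pnatr_eq0; lia| |].
    by rewrite oppr_eq0 pnatr_eq0; lia.
  have -> : (2 * j + 1 = 2 * p - (2 * k.+1 + 1))%N by lia.
  by apply: subn_natr_congr; lia.
apply: rat_congrV => //; [by zloc | by zloc | by rewrite invrN; zloc | |].
  by rewrite oppr_eq0 pnatr_eq0.
by rewrite /j -[p in (p - _)%N]mul1n; apply: subn_natr_congr; lia.
Qed.

Lemma central_bin_reflect_pcongr k : (0 < k <= n)%N ->
  'C(2 * (p - k), p - k)%:R / (p - k)%:R ≡
  p%:R * (2 * (k%:R ^+ 2 * 'C(2 * k, k)%:R)^-1) %[modr p ^ 2].
Proof.
move=> kn; have pk0 : (p - k)%:R != 0 :> rat by rewrite pnatr_eq0; lia.
have -> : 'C(2 * (p - k), p - k)%:R / (p - k)%:R =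
  p%:R * ('C(2 * (p - k), p - k)%:R / ((p - k)%:R * p%:R)) :> rat.
  by field; rewrite pk0 pR_neq0.
apply: (@rat_congr_pM 1 1); first exact: Zloc_ideal1.
exact: central_bin_reflect_congr.
Qed.

(** After k -> p-k the powers satisfy 4^(p-k) 4^k = 4^p = 4 w^2 with w = 1 modulo p, so the sum
    becomes p/2 times that of [sum_pow4_inv_central_bin_congr]. *)
Lemma sum_upper_central_bin_congr :
  \sum_(0 <= k < p | (p < 2 * k)%N) 'C(2 * k, k)%:R / (k%:R * 4 ^+ k) ≡
  (-1) ^+ n * 2 * p%:R * (euler (p - 3))%:~R %[modr p ^ 2].
Proof.
have -> : \sum_(0 <= k < p | (p < 2 * k)%N) 'C(2 * k, k)%:R / (k%:R * 4 ^+ k) =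
    \sum_(n.+1 <= k < (2 * n).+1) 'C(2 * k, k)%:R / (k%:R * 4 ^+ k) :> rat.
  rewrite -pE (@big_cat_nat _ _ _ n.+1) //=; last by lia.
  rewrite big_nat_cond big_pred0 ?add0r => [|k]; last by lia.
  by rewrite big_nat_cond [RHS]big_nat_cond; apply: eq_bigl => k; lia.
rewrite big_reflect -pE.
have wV : w^-1 \in Zloc by zloc.
apply: (@rat_congr_trans _ (\sum_(1 <= k < n.+1) (p%:R * (2 / (4 * w ^+ 2))) *
   (4 ^+ k / (k%:R ^+ 2 * 'C(2 * k, k)%:R)))).
  apply: rat_congr_sum => k kn.
  have pk0 : (p - k)%:R != 0 :> rat by rewrite pnatr_eq0; lia.
  have k0 : k%:R != 0 :> rat by rewrite pnatr_eq0; lia.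
  have c0 : 'C(2 * k, k)%:R != 0 :> rat by apply: binr_neq0; lia.
  have w0 : w != 0 by rewrite expf_neq0.
  have p4 : 4 * w ^+ 2 = 4 ^+ (p - k) * 4 ^+ k :> rat.
    rewrite -exprD subnK; last by lia.
    have -> : 4 = 2 ^+ 2 :> rat by ring.
    by rewrite -!exprM -exprD; congr (_ ^+ _); lia.
  have -> : 'C(2 * (p - k), p - k)%:R / ((p - k)%:R * 4 ^+ (p - k)) =
      4 ^+ k / (4 * w ^+ 2) * ('C(2 * (p - k), p - k)%:R / (p - k)%:R) :> rat.
    by rewrite p4; field; rewrite pk0 !expf_neq0.
  have -> : p%:R * (2 / (4 * w ^+ 2)) * (4 ^+ k / (k%:R ^+ 2 * 'C(2 * k,
    k)%:R)) =
    4 ^+ k / (4 * w ^+ 2) * (p%:R * (2 * (k%:R ^+ 2 * 'C(2 * k, k)%:R)^-1)) :>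
      rat.
    by field; rewrite c0 k0 expf_neq0.
  apply: rat_congrMl; first by rewrite invfM -exprVn; zloc.
  by apply: central_bin_reflect_pcongr; lia.
rewrite -mulr_sumr -mulrA.
have -> : (-1) ^+ n * 2 * p%:R * (euler (p - 3))%:~R =
  p%:R * (2^-1 * ((-1) ^+ n * 4 * (euler (p - 3))%:~R)) :> rat by field.
apply: (@rat_congr_pM 1 1); first exact: Zloc_ideal1.
apply: rat_congrM; [by zloc | | | exact: sum_pow4_inv_central_bin_congr].
  apply: rat_congr_Zloc sum_pow4_inv_central_bin_congr _ => //.
  by zloc.
have -> : 2 / (4 * w ^+ 2) = 2^-1 * w^-1 ^+ 2 :> rat.
  by field; rewrite expf_neq0.
rewrite -[X in _ ≡ X %[modr _ ^ _]]mulr1; apply: rat_congrMl; first by zloc.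
rewrite -[X in _ ≡ X %[modr _ ^ _]](expr1n _ 2); apply: rat_congrX;
  first exact: rpred1.
rewrite -[X in _ ≡ X %[modr _ ^ _]]invr1; apply: rat_congrV => //.
- by zloc.
- by rewrite invr1 rpred1.
- by rewrite expf_neq0.
exact: fermat_pow2_congr.
Qed.

Local Notation A := (\sum_(1 <= k < n.+1) (k%:R ^+ 2 * 'C(2 * k, k)%:R)^-1 :
  rat).
Local Notation B := (\sum_(1 <= k < n.+1) (k%:R ^+ 2 * 'C(n, k)%:R ^+ 2)^-1 :
  rat).

(** In Apery's identity C(n+k, k) is replaced by (-1)^k C(n, k), which turns the last sum into [B],
    and the alternating sum by its Euler number. *)
Lemma apery_congr :
  3 * A + 2 * ((-1) ^+ n * 2 * (euler (p - 3))%:~R) + (-1) ^+ n * B ≡ 0 %[modr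
    p ^ 1].
Proof.
rewrite -[X in _ ≡ X %[modr _ ^ _]](apery n); apply: rat_congrD; last first.
  apply: rat_congrMl; first by zloc.
  apply: rat_congr_sum => k kn; apply: rat_congr_sym.
  have s0 : (-1) ^+ k != 0 :> rat by rewrite signr_eq0.
  have c0 : 'C(n, k)%:R != 0 :> rat by apply: binr_neq0; lia.
  have d0 : 'C(n + k, k)%:R != 0 :> rat by apply: binr_neq0; lia.
  have k0 : k%:R != 0 :> rat by rewrite pnatr_eq0; lia.
  have -> : (-1) ^+ k / (k%:R ^+ 2 * 'C(n, k)%:R * 'C(n + k, k)%:R) =
    (-1) ^+ k / (k%:R ^+ 2 * 'C(n, k)%:R) * ('C(n + k, k)%:R)^-1 :> rat.
    by rewrite [in LHS]invfM mulrA.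
  have -> : (k%:R ^+ 2 * 'C(n, k)%:R ^+ 2)^-1 =
    (-1) ^+ k / (k%:R ^+ 2 * 'C(n, k)%:R) * ((-1) ^+ k * 'C(n, k)%:R)^-1 :> rat.
    by field; rewrite s0 c0 k0.
  apply: rat_congrMl; first by zloc.
  apply: rat_congrV => //.
  - by zloc.
  - by zloc.
  - by rewrite invfM invr_sign; zloc.
  - by rewrite mulf_neq0.
  by apply: bin_addn_congr; lia.
apply: rat_congrD; first exact: rat_congr_refl.
apply: rat_congrMl; first by zloc.
by apply: rat_congr_sym; exact: sum_alt_inv_sqr_euler_congr.
Qed.

Lemma B_loc : B \in Zloc.
Proof.
by rewrite big_nat_cond rpred_sum // => k; rewrite andbT => kn; zloc.
Qed.

(** The prefactor is (n+1)/3 C(p, n), where C(p, n) is -(-1)^n p/n modulo p^2 and (n+1)/n is -1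
    modulo p because 2n+1 = p. *)
Lemma staver_half_congr :
  \sum_(1 <= k < n.+1) 'C(2 * k, k)%:R / k%:R ≡ p%:R * ((-1) ^+ n / 3 * B)
    %[modr p ^ 2].
Proof.
rewrite staver_bin addn1 -pE.
have -> : p%:R * ((-1) ^+ n / 3 * B) = p%:R * ((-1) ^+ n / 3) * B by rewrite
  mulrA.
apply: rat_congrMr; first exact: B_loc.
have n0 : n%:R != 0 :> rat by rewrite pnatr_eq0; lia.
have := bin_mulp_congr (isT : 0 < 1)%N (_ : 0 < n < p)%N.
rewrite mul1n => H; have {}H := rat_congr_le (isT : 2 <= 3)%N (H _).
set h := \sum_(_ <= _ < _) _ in H.
have h_loc : h \in Zloc.
  by rewrite /h big_nat_cond rpred_sum // => i; rewrite andbT => ij; zloc.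
apply: (rat_congr_trans (rat_congrMl _ (H _))); [by zloc | by lia |].
rewrite rat_congrE [X in X \in _](_ : _ = p%:R ^+ 2 * ((-1) ^+ n * (n.+1%:R / 3
  / n%:R * h
   - (3 * n%:R)^-1))); last first.
  rewrite pRE -[n.+1%:R]natr1; field.
  exact: n0.
by apply: Zloc_idealMr; [exact: Zloc_idealX | rewrite invfM; zloc].
Qed.

Lemma Zloc_ideal_pM m x : p%:R * x \in Zloc_ideal m.+1 -> x \in Zloc_ideal m.
Proof.
rewrite ![_ \in Zloc_ideal _]unfold_in exprS invfM mulrACA.
by rewrite divff ?mul1r // pR_neq0.
Qed.

(** Staver's identity at p-1: its prefactor contains p, and since C(p-1, k)^2 is 1 modulo p the
    remaining sum reduces to that of 1/k^2, also divisible by p. *)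
Lemma sum_central_bin_congr0 :
  \sum_(1 <= k < p) 'C(2 * k, k)%:R / k%:R ≡ 0 %[modr p ^ 2].
Proof.
have pp := prednK (prime_gt0 p_prime).
have := staver_bin p.-1; rewrite pp => ->.
have S0 : \sum_(1 <= k < p) (k%:R ^+ 2 * 'C(p.-1, k)%:R ^+ 2)^-1 ≡ 0 %[modr p ^
  1].
  apply: rat_congr_trans sum_inv_sqr_congr0; apply: rat_congr_sum => k kp.
  rewrite invfM -[X in _ ≡ X %[modr _ ^ _]]mulr1; apply: rat_congrMl;
    first by zloc.
  rewrite -exprVn -[X in _ ≡ X %[modr _ ^ _]](sqrr_sign _ k).
  apply: rat_congrX; first by zloc.
  rewrite -[X in _ ≡ X %[modr _ ^ _]]invr_sign; apply: rat_congrV => //.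
  - by zloc.
  - by zloc.
  - by rewrite invr_sign; zloc.
  - by apply: binr_neq0; lia.
  - by rewrite signr_eq0.
  by apply: bin_p_pred_congr; lia.
rewrite -[X in _ ≡ X %[modr _ ^ _]](mulr0 (p%:R / 3 * 'C(2 * p.-1 + 1,
  p.-1)%:R)).
apply: (@rat_congr_pM 1 1) S0.
rewrite -mulrA; apply: Zloc_idealMr; first exact: Zloc_ideal1.
by zloc.
Qed.

(** Cutting the full sum at n and reflecting its upper half gives -2pA for the lower half, while
    Staver's identity gives p (-1)^n B/3. Cancelling p, (-1)^n B = -6A modulo p, and [apery_congr]
    then determines A. *)
Lemma half_sums_congr :
  A ≡ (-1) ^+ n * (4 / 3) * (euler (p - 3))%:~R %[modr p ^ 1] /\
  \sum_(1 <= k < n.+1) 'C(2 * k, k)%:R / k%:R ≡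
    - (p%:R * (2 * A)) %[modr p ^ 2].
Proof.
set a := A; set b := B; set c := \sum_(1 <= k < n.+1) 'C(2 * k, k)%:R / k%:R.
set E := (euler _)%:~R; pose s : rat := (-1) ^+ n.
have s_loc : s \in Zloc by rewrite /s; zloc.
have Hs : c ≡ - (p%:R * (2 * a)) %[modr p ^ 2].
  have := sum_central_bin_congr0.
  rewrite (@big_cat_nat _ _ _ n.+1) //=; last by lia.
  rewrite -/c pE big_reflect -pE => H0.
  have H1 : \sum_(1 <= k < n.+1) 'C(2 * (p - k), p - k)%:R / (p - k)%:R ≡
      p%:R * (2 * a) %[modr p ^ 2].
    by rewrite /a !mulr_sumr; apply: rat_congr_sum => k;
      exact: central_bin_reflect_pcongr.
  have := rat_congrB H0 H1; rewrite sub0r; congr rat_congr.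
  by rewrite addrK.
split=> //.
have Hb := staver_half_congr; rewrite -/b -/c -/s in Hb.
have Ha := apery_congr; rewrite -/a -/b -/E -/s rat_congrE subr0 in Ha.
have Hab : s / 3 * b + 2 * a \in Zloc_ideal 1.
  apply: Zloc_ideal_pM; rewrite mulrDr -[X in X \in _]opprK rpredN.
  have := rat_congr_trans (rat_congr_sym Hb) Hs; rewrite rat_congrE opprK => H.
  by rewrite rpredN.
rewrite rat_congrE.
have -> : a - (-1) ^+ n * (4 / 3) * E = (s / 3 * b + 2 * a)
  + - 3^-1 * (3 * a + 2 * (s * 2 * E) + s * b) by rewrite -/s; field.
by apply: Zloc_idealD => //; apply: Zloc_idealMl => //; zloc.
Qed.

End PrimeLocalization.

(** The general argument inverts 3, so the prime 3 is settled by evaluation. *)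
Lemma sun_congruences_3 :
  [/\ \sum_(0 <= k < 3) 'C(2 * k, k)%:R / 2 ^+ k
        ≡ (-1) ^+ (3 - 1)./2 - 3%:R ^+ 2 * (euler (3 - 3))%:~R %[modr 3 ^ 3],
      \sum_(1 <= k < (3 - 1)./2.+1) 4 ^+ k / (k%:R ^+ 2 * 'C(2 * k, k)%:R)
        ≡ (-1) ^+ (3 - 1)./2 * 4 * (euler (3 - 3))%:~R %[modr 3 ^ 1]
    & \sum_(0 <= k < 3 | (3 < 2 * k)%N) 'C(2 * k, k)%:R / (k%:R * 4 ^+ k)
        ≡ (-1) ^+ (3 - 1)./2 * 2 * 3%:R * (euler (3 - 3))%:~R %[modr 3 ^ 2]].
(* The iterated sums are locked; [unlock] lets them compute. *)
Proof. by split; rewrite unlock; vm_compute. Qed.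

Theorem theorem1p1 (p : nat) (p_prime : prime p) (p_odd : odd p) :
  [/\ \sum_(0 <= k < p) 'C(2 * k, k)%:R / 2 ^+ k
        ≡ (-1) ^+ (p - 1)./2 - p%:R ^+ 2 * (euler (p - 3))%:~R %[modr p ^ 3],
      (3 < p)%N ->
        \sum_(1 <= k < (p - 1)./2.+1) 'C(2 * k, k)%:R / k%:R
          ≡ (-1) ^+ (p + 1)./2 * (8 / 3) * p%:R * (euler (p - 3))%:~R
          %[modr p ^ 2]
        /\
        \sum_(1 <= k < (p - 1)./2.+1) 1 / (k%:R ^+ 2 * 'C(2 * k, k)%:R)
          ≡ (-1) ^+ (p - 1)./2 * (4 / 3) * (euler (p - 3))%:~R %[modr p ^ 1],
      \sum_(1 <= k < (p - 1)./2.+1) 4 ^+ k / (k%:R ^+ 2 * 'C(2 * k, k)%:R)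
        ≡ (-1) ^+ (p - 1)./2 * 4 * (euler (p - 3))%:~R %[modr p ^ 1]
    & \sum_(0 <= k < p | (p < 2 * k)%N) 'C(2 * k, k)%:R / (k%:R * 4 ^+ k)
        ≡ (-1) ^+ (p - 1)./2 * 2 * p%:R * (euler (p - 3))%:~R %[modr p ^ 2]].
Proof.
have [p_gt3 | p_le3] := ltnP 3 p; last first.
  have -> : p = 3 by move: p_prime p_odd p_le3; case: p => [|[|[|[|]]]].
  by case: sun_congruences_3.
have [n pE] : exists n, p = (2 * n).+1 by exists p./2; lia.
have n_gt1 : (1 < n)%N by lia.
have -> : (p - 1)./2 = n by lia.
have -> : (p + 1)./2 = n.+1 by lia.
have [HA HS] := half_sums_congr p_prime pE n_gt1.
split; first exact: sum_central_bin_pow2_congr.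
- move=> _; split.
    apply: (rat_congr_trans p_prime HS).
    have -> : (-1) ^+ n.+1 * (8 / 3) * p%:R * (euler (p - 3))%:~R =
      - (p%:R * (2 * ((-1) ^+ n * (4 / 3) * (euler (p - 3))%:~R))) :> rat.
      by rewrite exprS; field.
    apply: rat_congrN => //; apply: (@rat_congr_pM _ p_prime 1 1).
      exact: Zloc_ideal1.
    by apply: rat_congrMl => //; exact: Zloc_nat.
  by under eq_bigr do rewrite div1r.
- exact: sum_pow4_inv_central_bin_congr.
exact: sum_upper_central_bin_congr.
Qed.
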